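(* The operator $\mathsf{H}_\mu$ is densely defined in $L^2(\Omega)$.
   Context: Let $d\ge 2$ and let $\Omega\subset\mathbb{R}^d$ be a bounded, connected, $C^2$-smooth open set. Let $a\colon\Omega\to M_d(\mathbb{R})$ be a symmetric matrix function with real-valued entries in $C^1(\overline\Omega)$ such that for some $c>0$ one has $\xi\cdot a(x)\xi\ge c|\xi|^2$ for all $\xi\in\mathbb{R}^d$, $x\in\Omega$. Function spaces are complex-valued. Let $\mu$ be a Radon probability measure on $\Omega$ such that $H^2(\Omega)\ni u\mapsto \langle u\rangle_\mu := \int_\Omega u\,d\mu$ is a continuous functional on $H^2(\Omega)$. Write $\nabla\cdot a\nabla u=\sum_{i,j}\partial_i(a_{ij}\partial_j u)$. In the Hilbert space $L^2(\Omega)$ define the operator $$\mathsf{H}_\mu u := -\nabla\cdot a\nabla u,\qquad \mathrm{dom}\,\mathsf{H}_\mu := \{u\in H^2(\Omega): u|_{\partial\Omega}=\langle u\rangle_\mu\}$$ (the trace of $u$ on $\partial\Omega$ equals the constant $\langle u\rangle_\mu$). *)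

(* Defs.v *)
From HB Require Import structures.
From mathcomp Require Import all_boot all_order all_algebra.
From mathcomp Require Import complex.
From mathcomp Require Import all_classical all_reals all_analysis.
Set Implicit Arguments. Unset Strict Implicit. Unset Printing Implicit Defensive.
Import Order.TTheory GRing.Theory Num.Theory.
Import numFieldNormedType.Exports.
Local Open Scope classical_set_scope.
Local Open Scope ring_scope.

(* The Borel sigma-algebra of R^n. *)
HB.instance Definition _ (R : realType) (m n : nat) :=
  Measurable.copy 'M[R]_(m, n) (g_sigma_algebraType (open : set (set 'M[R]_(m, n)))).

Section lebesgue_rV.
Variable R : realType.

Lemma rV_open_bigcup n (U : set 'rV[R]_n) : open U ->
  U = \bigcup_(qk in
        [set qk : 'rV[rat]_n * nat | ball (map_mx ratr qk.1 : 'rV[R]_n) qk.2.+1%:R^-1 `<=` U])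
      ball (map_mx ratr qk.1 : 'rV[R]_n) qk.2.+1%:R^-1.
Proof.
move=> oU; apply/seteqP; split => [x Ux|x [qk /= qU] /qU //].
have [e /= e0 eU] : nbhs_ball x U by apply/nbhs_ballP/open_nbhs_nbhs.
have [k kge] : exists k : nat, k.+1%:R^-1 < e / 2.
  have /ltr_add_invr[k] : 0 < e / 2 by rewrite divr_gt0.
  by rewrite add0r => ke; exists k.
pose r : R := k.+1%:R^-1.
have r0 : 0 < r by rewrite invr_gt0 ltr0n.
have /choice[q qP] (i : 'I_n) : exists q : rat, `|x 0 i - ratr q| < r.
  have [q qi] : exists q : rat, ratr q \in `](x 0 i - r), (x 0 i + r)[.
    by apply: rat_in_itvoo; rewrite ltrBlDr -addrA ltrDl addr_gt0.
  exists q; move: qi; rewrite in_itv/= => /andP[q1 q2].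
  by rewrite distrC ltr_distl q1 q2.
exists (\row_i q i, k) => /=; last first.
  split=> // i j; rewrite !mxE ord1 /ball/= distrC; exact: qP.
move=> y [_ qy]; apply: eU; split=> // i j.
rewrite ord1; apply: le_lt_trans (_ : r + r < e).
  apply: le_trans (ler_distD (ratr (q j)) _ _) _.
  apply: lerD; first exact/ltW/qP.
  by have := qy 0 j; rewrite !mxE => /ltW.
by rewrite [ltRHS](splitr e) ltrD.
Qed.

Definition cons_rV n (p : measurableTypeR R * 'rV[R]_n) : 'rV[R]_n.+1 :=
  row_mx (p.1%:M : 'rV[R]_1) p.2.

Lemma cons_rV0 n p : @cons_rV n p 0 ord0 = p.1.
Proof.
have E : ord0 = lshift n (ord0 : 'I_1) by exact: val_inj.
by rewrite E; apply: etrans (row_mxEl _ _ _ _) _; rewrite mxE eqxx mulr1n.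
Qed.

Lemma cons_rVS n p i : @cons_rV n p 0 (lift ord0 i) = p.2 0 i.
Proof.
have E : lift ord0 i = rshift 1 i by exact: val_inj.
by rewrite E; exact: row_mxEr.
Qed.

Lemma measurable_fun_rV d (T : measurableType d) n (f : T -> 'rV[R]_n) :
  (forall i, measurable_fun setT (fun t => f t 0 i)) -> measurable_fun setT f.
Proof.
move=> mf; apply: (measurability (open : set (set 'rV[R]_n))) => // _ [U oU <-].
rewrite setTI (rV_open_bigcup oU) preimage_bigcup.
rewrite bigcup_mkcond; apply: countable_bigcupT_measurable => [|[q k]].
  exact: countableP.
case: ifPn => // _ /=.
rewrite (_ : _ @^-1` _ = \bigcap_(i in [set: 'I_n])
    (fun t => f t 0 i) @^-1` ball (ratr (q 0 i) : R) k.+1%:R^-1); last first.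
  apply/seteqP; split=> [t [_ qt] i _|t qt].
    by have := qt 0 i; rewrite mxE.
  by split=> [|i j]; rewrite ?invr_gt0// ord1 mxE; exact: qt.
apply: fin_bigcap_measurable => [|i _]; first exact: finite_finset.
rewrite -[X in measurable X]setTI; apply: mf => //.
exact: measurable_realfun.measurable_ball.
Qed.

Lemma measurable_coord n (i : 'I_n) :
  measurable_fun setT (fun v : 'rV[R]_n => v 0 i).
Proof.
apply: (measurability _ (measurable_realfun.RGenOpens.measurableE R)) => _ [_ [a [b ->]] <-].
rewrite setTI; apply: sub_sigma_algebra.
apply: open_comp; last exact: interval_open.
by move=> v _; exact: coord_continuous.
Qed.

Lemma measurable_cons_rV n : measurable_fun setT (@cons_rV n).
Proof.
apply: measurable_fun_rV => i; case: (unliftP ord0 i) => [j|] ->.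
  rewrite (_ : (fun _ => _) = (fun v : 'rV[R]_n => v 0 j) \o snd).
    exact: measurableT_comp (measurable_coord _) measurable_snd.
  by apply/funext => p /=; rewrite cons_rVS.
rewrite (_ : (fun _ => _) = fst); first exact: measurable_fst.
by apply/funext => p; rewrite cons_rV0.
Qed.


HB.instance Definition _ n := isMeasurableFun.Build _ _ _ _ (@cons_rV n) (@measurable_cons_rV n).

Section lebesgue_rV_step.
Local Open Scope ereal_scope.
Context n (m : {sigma_finite_measure set 'rV[R]_n -> \bar R}).

Definition lebesgue_rV_step : set 'rV[R]_n.+1 -> \bar R :=
  pushforward (@lebesgue_measure R \x m) (@cons_rV n).

Let step0 : lebesgue_rV_step set0 = 0.
Proof. exact: measure0. Qed.

Let step_ge0 A : 0 <= lebesgue_rV_step A.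
Proof. exact: measure_ge0. Qed.

Let step_sigma_additive : semi_sigma_additive lebesgue_rV_step.
Proof. exact: measure_semi_sigma_additive. Qed.

HB.instance Definition _ := isMeasure.Build _ _ _ lebesgue_rV_step
  step0 step_ge0 step_sigma_additive.

Let step_sigma_finite : sigma_finite setT lebesgue_rV_step.
Proof.
have /sigma_finiteP[F [FT ndF Foo]] := sigma_finiteT (@lebesgue_measure R).
have /sigma_finiteP[G [GT ndG Goo]] := sigma_finiteT m.
pose u (v : 'rV[R]_n.+1) : measurableTypeR R * 'rV[R]_n :=
  (v 0%R ord0, \row_i v 0%R (lift ord0 i)).
have uK p : u (cons_rV p) = p.
  rewrite /u cons_rV0 [RHS]surjective_pairing; congr pair.
  by apply/rowP => i; rewrite mxE cons_rVS.
have mu_ : measurable_fun setT u.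
  apply/measurable_fun_pair; first exact: measurable_coord.
  apply: measurable_fun_rV => i.
  rewrite (_ : (fun _ => _) = (fun v : 'rV[R]_n.+1 => v 0%R (lift ord0 i))).
    exact: measurable_coord.
  by apply/funext => v; rewrite mxE.
exists (fun k => u @^-1` (F k `*` G k)).
  rewrite -preimage_bigcup; apply/esym; rewrite -subTset => v _ /=.
  have [i _ Fi] : (\bigcup_i F i) (u v).1 by rewrite -FT.
  have [j _ Gj] : (\bigcup_i G i) (u v).2 by rewrite -GT.
  exists (maxn i j) => //; split.
  - by move: Fi; exact/subsetPset/ndF/leq_maxl.
  - by move: Gj; exact/subsetPset/ndG/leq_maxr.
move=> k; have [mF Fk] := Foo k; have [mG Gk] := Goo k; split.
  by rewrite -[X in measurable X]setTI; apply: mu_ => //; exact: measurableX.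
rewrite /lebesgue_rV_step /pushforward (_ : _ @^-1` _ = F k `*` G k).
  by rewrite product_measure1E// lte_mul_pinfty// ge0_fin_numE.
by rewrite -comp_preimage (_ : u \o _ = id)//; apply/funext => p /=; rewrite uK.
Qed.

HB.instance Definition _ := Measure_isSigmaFinite.Build _ _ _
  lebesgue_rV_step step_sigma_finite.

End lebesgue_rV_step.

(* Lebesgue measure on the Borel sets of R^n, as an iterated product measure. *)
Fixpoint lebesgue_rV n : {sigma_finite_measure set 'rV[R]_n -> \bar R} :=
  if n is n'.+1 return {sigma_finite_measure set 'rV[R]_n -> \bar R}
  then lebesgue_rV_step (lebesgue_rV n') else dirac (0 : 'rV[R]_0).

End lebesgue_rV.
Arguments lebesgue_rV R n : clear implicits.

(* The library norm on 'rV[R]_n is the sup norm. *)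
Definition enorm (R : realType) n (x : 'rV[R]_n) : R :=
  Num.sqrt (\sum_i x 0 i ^+ 2).

Section hausdorff.
Local Open Scope ereal_scope.
Context (R : realType) (n : nat).
Implicit Types (s : nat) (e : R) (A : set 'rV[R]_n).

Definition diam A : \bar R :=
  ereal_sup [set (enorm (x.1 - x.2))%:E | x in A `*` A].

Definition hausdorff_gauge s e A : \bar R :=
  if A == set0 then 0 else if diam A <= e%:E then diam A ^+ s else +oo.

(* [mu_ext] takes the infimum over countable Borel covers; these suffice, since
   closing a set does not change its diameter. There is no normalizing factor,
   so on a hypersurface of R^n, [hausdorff n.-1] is a constant positive multiple
   of the surface measure. *)
Definition hausdorff s A : \bar R :=
  ereal_sup [set mu_ext (hausdorff_gauge s e) A | e in [set e | (0 < e)%R]].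

Let gauge0 s e : hausdorff_gauge s e set0 = 0.
Proof. by rewrite /hausdorff_gauge eqxx. Qed.

Let gauge_ge0 s e A : 0 <= hausdorff_gauge s e A.
Proof.
rewrite /hausdorff_gauge; case: ifPn => // /set0P[x Ax].
case: ifPn => // _; apply: expe_ge0; apply: ereal_sup_ubound.
exists (x, x) => //=; rewrite subrr /enorm big1 ?sqrtr0// => i _.
by rewrite mxE expr0n.
Qed.

Let hausdorff0 s : hausdorff s set0 = 0.
Proof.
apply/eqP; rewrite eq_le; apply/andP; split.
  by apply: ge_ereal_sup => _ [e _ <-]; rewrite (mu_ext0 (gauge0 _ _) (gauge_ge0 _ _)).
by apply: ereal_sup_ubound; exists 1%R; rewrite /= ?(mu_ext0 (gauge0 _ _) (gauge_ge0 _ _)).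
Qed.

Let hausdorff_ge0 s A : 0 <= hausdorff s A.
Proof.
apply: le_trans (ereal_sup_ubound _); last by exists 1%R => /=.
exact: (mu_ext_ge0 (gauge_ge0 _ _)).
Qed.

Let le_hausdorff s : {homo hausdorff s : A B / A `<=` B >-> A <= B}.
Proof.
move=> A B AB; apply: ge_ereal_sup => _ [e e0 <-].
apply: le_trans (ereal_sup_ubound _); last by exists e.
exact: le_mu_ext.
Qed.

Let hausdorff_sigma_subadditive s : sigma_subadditive (hausdorff s).
Proof.
move=> F; apply: ge_ereal_sup => _ [e e0 <-].
apply: le_trans (mu_ext_sigma_subadditive (gauge_ge0 _ _) _) _.
apply: lee_nneseries => [k _ _|k _]; first exact: (mu_ext_ge0 (gauge_ge0 _ _)).
by apply: ereal_sup_ubound; exists e.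
Qed.

HB.instance Definition _ s := isOuterMeasure.Build R 'rV[R]_n (hausdorff s)
  (hausdorff0 s) (hausdorff_ge0 s) (@le_hausdorff s)
  (@hausdorff_sigma_subadditive s).

End hausdorff.

Section hausdorff_measure.
Context (R : realType) (n s : nat).

Definition hausdorff_measure :
    set (caratheodory_type (@hausdorff R n s)) -> \bar R := hausdorff s.

Let hausdorff_measure0 : hausdorff_measure set0 = 0%E.
Proof. exact: outer_measure0. Qed.

Let hausdorff_measure_ge0 A : (0 <= hausdorff_measure A)%E.
Proof. exact: outer_measure_ge0. Qed.

Let hausdorff_measure_sigma_additive : semi_sigma_additive hausdorff_measure.
Proof. exact: caratheodory_measure_sigma_additive. Qed.

HB.instance Definition _ := isMeasure.Build _ _ _ hausdorff_measure
  hausdorff_measure0 hausdorff_measure_ge0 hausdorff_measure_sigma_additive.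

End hausdorff_measure.
Arguments hausdorff_measure R n s : clear implicits.

Section smooth_functions.
Context (R : realType) (n : nat).
Implicit Types (U K : set 'rV[R]_n) (f : 'rV[R]_n -> R).

(* Class C^k on an open set U; the values of f outside U are irrelevant. *)
Fixpoint Ck k U f : Prop :=
  (forall x, U x -> {for x, continuous f}) /\
  if k is k'.+1 then
    forall i : 'I_n, (forall x, U x -> derivable f x 'e_i) /\ Ck k' U ('D_'e_i f)
  else True.

Definition smooth f := forall k, Ck k setT f.

Definition test_function U f := smooth f /\
  exists K, [/\ compact K, K `<=` U & forall x, ~ K x -> f x = 0].

Definition extends_to_closure U f := exists g : 'rV[R]_n -> R,
  {within closure U, continuous g} /\ forall x, U x -> g x = f x.

Definition C1_closure U f :=
  [/\ Ck 1 U f, extends_to_closure U f &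
      forall i : 'I_n, extends_to_closure U ('D_'e_i f)].

Definition boundary U := closure U `\` interior U.

End smooth_functions.

(* Near each boundary point, after relabelling and reorienting the coordinate
   axes, U is the set of points lying above the graph of a C^2 function of the
   remaining n-1 coordinates. *)
Definition C2_boundary (R : realType) n (U : set 'rV[R]_n) :=
  forall x0, boundary U x0 ->
  exists (r : R) (i : 'I_n) (b : bool) (h : 'rV[R]_n.-1 -> R),
    [/\ 0 < r, Ck 2 setT h &
        forall x : 'rV[R]_n, enorm (x - x0) < r ->
          (U x <-> h (col' i x) < (-1) ^+ b * x 0 i)].

Section complex_integrals.
Context disp (T : measurableType disp) (R : realType).
Variables (m : {measure set T -> \bar R}) (D : set T).
Implicit Type f : T -> R[i].

Definition Cintegral f : R[i] :=
  ((\int[m]_(x in D) complex.Re (f x)) +i*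
   (\int[m]_(x in D) complex.Im (f x)))%C.

(* The square of the L^2 norm. *)
Definition L2norm2 f : \bar R :=
  (\int[m]_(x in D) (ComplexField.Normc.normc (f x) ^+ 2)%:E)%E.

End complex_integrals.

(* Elements of L^2(Omega) and of the Sobolev spaces H^k(Omega) are represented
   by functions on R^d, whose values outside Omega are irrelevant; equality in
   L^2(Omega) is equality almost everywhere on Omega. *)
Section sobolev.
Context (R : realType) (d : nat) (Omega : set 'rV[R]_d).
Local Notation lambda := (lebesgue_rV R d).
Local Notation fct := ('rV[R]_d -> R[i]).
Implicit Types (u v g : fct) (k : nat) (i : 'I_d).

Definition L2 u : Prop :=
  [/\ measurable_fun Omega (fun x => complex.Re (u x)),
      measurable_fun Omega (fun x => complex.Im (u x)) &
      (L2norm2 lambda Omega u < +oo)%E].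

Definition weak_derivative i u g : Prop :=
  forall phi : 'rV[R]_d -> R, test_function Omega phi ->
  Cintegral lambda Omega (fun x => u x * ('D_'e_i phi x)%:C%C) =
  - Cintegral lambda Omega (fun x => g x * (phi x)%:C%C).

(* The weak derivative of u with respect to the i-th variable, when it exists
   in L^2(Omega); it is then unique almost everywhere on Omega. *)
Definition wD i u : fct :=
  xget (fun=> 0) [set g | L2 g /\ weak_derivative i u g].

Fixpoint sobolev k u : Prop :=
  L2 u /\
  if k is k'.+1 then forall i, exists g, weak_derivative i u g /\ sobolev k' g
  else True.

(* The square of the H^k norm. *)
Fixpoint sobolev_norm2 k u : \bar R :=
  (L2norm2 lambda Omega u +
   if k is k'.+1 then \sum_i sobolev_norm2 k' (wD i u) else 0)%E.

Definition sobolev_cvg k (v : nat -> fct) u : Prop :=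
  sobolev_norm2 k (fun x => v n x - u x) @[n --> \oo] --> 0%E.

(* C^oo(closure Omega) consists of the restrictions of these functions. *)
Definition Csmooth u : Prop :=
  smooth (fun x => complex.Re (u x)) /\ smooth (fun x => complex.Im (u x)).

(* The trace of u on the boundary is g: the trace operator is the continuous
   extension, from H^1(Omega) to L^2(boundary Omega), of the restriction to the
   boundary of functions in C^oo(closure Omega). *)
Definition is_trace u g : Prop :=
  exists v : nat -> fct, [/\ forall n, Csmooth (v n), sobolev_cvg 1 v u &
    L2norm2 (hausdorff_measure R d d.-1) (boundary Omega)
      (fun x => v n x - g x) @[n --> \oo] --> 0%E].

End sobolev.

Section mean.
Context (R : realType) (d : nat) (Omega : set 'rV[R]_d).
Variable mu : probability 'rV[R]_d R.
Local Notation fct := ('rV[R]_d -> R[i]).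

(* mu, extended by 0 outside Omega, is a Radon probability measure on Omega. *)
Definition radon_probability : Prop :=
  mu Omega = 1%E /\
  forall A, measurable A -> A `<=` Omega ->
    mu A = ereal_sup [set mu K | K in [set K | compact K /\ K `<=` A]].

(* Elements of H^2(Omega) are only defined up to Lebesgue-null sets, which mu
   may charge. So the functional u |-> \int_Omega u dmu on H^2(Omega) is
   understood as the continuous extension of the one given by the integral on
   C^oo(closure Omega), a dense subspace. *)
Definition mean_continuous : Prop :=
  exists c : R, forall u : fct, Csmooth u ->
    ((ComplexField.Normc.normc (Cintegral mu Omega u) ^+ 2)%:E <=
     c%:E * sobolev_norm2 Omega 2 u)%E.

Definition mean (u : fct) : R[i] :=
  xget 0 [set z | exists v : nat -> fct,
    [/\ forall n, Csmooth (v n), sobolev_cvg Omega 2 v u &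
        ComplexField.Normc.normc (Cintegral mu Omega (v n) - z)
          @[n --> \oo] --> (0 : R)]].

End mean.

Record operator (R : realType) d := Operator {
  dom : set ('rV[R]_d -> R[i]);
  act : ('rV[R]_d -> R[i]) -> 'rV[R]_d -> R[i] }.

Definition densely_defined (R : realType) d (Omega : set 'rV[R]_d)
    (H : operator R d) : Prop :=
  dom H `<=` L2 Omega /\
  forall f, L2 Omega f -> forall e : R, 0 < e ->
    exists2 u, dom H u &
      (L2norm2 (lebesgue_rV R d) Omega (fun x => (f x - u x)%R) < (e ^+ 2)%:E)%E.

Definition Hmu (R : realType) d (Omega : set 'rV[R]_d)
    (a : 'rV[R]_d -> 'M[R]_d) (mu : probability 'rV[R]_d R) : operator R d :=
  Operator
    [set u | sobolev Omega 2 u /\ is_trace Omega u (fun=> mean Omega mu u)]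
    (fun u x => - \sum_i \sum_j
      wD Omega i (fun y => (a y i j)%:C%C * wD Omega j u y) x).

(* Main.v *)
Require Import Defs.
From mathcomp Require Import all_boot all_order all_algebra.
From mathcomp Require Import complex ring lra.
From mathcomp Require Import all_classical all_reals all_analysis.
From mathcomp Require Import measurable_realfun.
Import Order.TTheory GRing.Theory Num.Theory.
Import numFieldNormedType.Exports.
Local Open Scope classical_set_scope.
Local Open Scope ring_scope.

(** The domain of the operator contains every smooth [u] that takes, outside
    [Omega], the constant value [\int_Omega u dmu]: its trace is this constant,
    and its mean is the integral itself. So it suffices to approximate a given
    [f] in L^2 by such functions, and the real and imaginary parts can be
    treated separately. For a test function [phi] close to [f] and a test
    function [chi] whose [mu]-average is positive, the function

      u = phi + alpha (1 - chi),   alpha = (\int phi dmu) / (\int chi dmu),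

    equals [alpha] outside [Omega], and its [mu]-average is
    [\int phi dmu + alpha (1 - \int chi dmu) = alpha], as [mu] is a
    probability. If [chi] is close to [1] both in L^2(dx) and in L^2(mu), then
    [\int chi dmu] stays above [1/2], so that [alpha] is bounded in terms of
    [phi] alone, while [1 - chi] is small in L^2(dx): hence [u] is close to
    [phi] ([dense_constant_outside]).

    Both approximations are instances of [test_dense]: test functions are dense
    in L^2(m) for every Borel measure [m] that is finite on [Omega]. For [chi]
    it is applied to the constant 1 and to the sum of Lebesgue measure and [mu].
    It is proved with a bump function built from [exp (-1/x)], countably many
    cubes for the indicator of an open set, the pi-lambda theorem for the
    indicator of a Borel set, and simple functions for the general case.

    That a smooth [u] lies in the domain requires two more facts. Its classical
    derivatives are weak derivatives, because the integral of a derivative of a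
    compactly supported function vanishes ([integral_derivative]). And the
    trace and the mean are defined by sequences converging to [u] in a Sobolev
    norm that selects weak derivatives with a choice operator; so the constant
    sequence [u] converges to [u] only because every weak derivative of [0]
    vanishes almost everywhere, by the fundamental lemma of the calculus of
    variations ([sqnorm_eq0], [null_sobolev_norm2]). The continuity of the mean
    on H^2 then makes the limit that defines it unique ([mean_Csmooth]). *)

Set Implicit Arguments.
Unset Strict Implicit.
Unset Printing Implicit Defensive.

(** * A smooth function vanishing on the negative half-line *)
Section flat.
Variable R : realType.
Implicit Types (p : {poly R}) (x : R).

(** The polynomial factor makes this family stable under differentiation: the
    derivative of [p(1/x) exp(-1/x)] is [q(1/x) exp(-1/x)] with
    [q = X^2 (p - p')]. *)
Definition flat p x : R := if 0 < x then p.[x^-1] * expR (- x^-1) else 0.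

(** With [y = 1/x], each monomial satisfies [y^i exp(-y) <= (i+1)! / y], by the
    term of degree [i+1] of the exponential series. *)
Lemma flat_le p : exists2 C : R, 0 <= C & forall x, `|flat p x| <= C * `|x|.
Proof.
pose C := \sum_(i < size p) `|p`_i| * (i.+1`!)%:R.
have C0 : 0 <= C by apply: sumr_ge0 => i _; rewrite mulr_ge0.
exists C => // x; rewrite /flat; case: ifPn => [x0|_]; last by rewrite normr0 mulr_ge0.
have y0 : 0 < x^-1 by rewrite invr_gt0.
rewrite horner_coef mulr_suml (gtr0_norm x0) mulr_suml.
apply: le_trans (ler_norm_sum _ _ _) _; apply: ler_sum => i _.
rewrite normrM normrM -!mulrA ler_wpM2l// normrX (gtr0_norm y0) (gtr0_norm (expR_gt0 _)).
rewrite expRN ler_pdivrMr ?expR_gt0//.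
have := @expR_ge1Dxn R x^-1 i (ltW y0).
move: (expR _) => E hE.
have f0 : 0 < i.+1`!%:R :> R by rewrite ltr0n fact_gt0.
have {hE} : x^-1 ^+ i.+1 <= i.+1`!%:R * E.
  rewrite mulrC -ler_pdivrMr//; lra.
rewrite exprS -(ler_pM2l x0) mulrA divff ?gt_eqF// mul1r => h.
by rewrite mulrAC (mulrC _ x).
Qed.

Lemma flat0 p : flat p 0 = 0. Proof. by rewrite /flat ltxx. Qed.

Lemma continuous_flat0 p : {for 0, continuous (flat p)}.
Proof.
have [C C0 h] := flat_le p.
rewrite /prop_for/continuous_at flat0; apply/norm_cvg0P.
apply: (@squeeze_cvgr _ _ _ _ (cst 0) (fun x => C * `|x|)).
- by near=> x; rewrite h /= normr_ge0.
- exact: cvg_cst.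
- rewrite -[X in _ --> X](mulr0 C); apply: cvgM; first exact: cvg_cst.
  by rewrite -[X in _ --> X](normr0 R); apply: cvg_norm; exact: cvg_id.
Unshelve. all: by end_near. Qed.

(** At [0], the difference quotient of [flat p] is [flat (p * 'X)], which tends
    to [0] by [flat_le]. *)
Lemma is_derive_flat p x : is_derive x 1 (flat p) (flat ('X^2 * (p - p^`())) x).
Proof.
have [x0|x0|<-] := ltgtP 0 x.
- rewrite {2}/flat x0.
  apply: (@near_eq_is_derive _ _ _ (fun x => p.[x^-1] * expR (- x^-1))).
    by near=> y; rewrite /flat ifT//; near: y; exact: lt_nbhsr.
  have xn0 : x != 0 by rewrite gt_eqF.
  have dV : is_derive x 1 (fun y : R => y^-1) (- x ^- 2).
    by have := @is_deriveV R id x 1 1 xn0 (is_derive_id x 1); rewrite /GRing.scale/= mulr1.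
  have dp : is_derive x 1 (horner p \o (fun y => y^-1)) (p^`().[x^-1] * (- x ^- 2)).
    exact: is_derive1_comp.
  have de : is_derive x 1 (expR \o (fun y => - y^-1)) (expR (- x^-1) * (x ^- 2)).
    apply: is_derive1_comp; apply: (@is_derive_eq _ _ _ _ _ _ _ (- (- x ^- 2))).
    by rewrite opprK.
  apply: (is_derive_eq (is_deriveM dp de)).
  rewrite hornerM hornerXn hornerD hornerN -exprVn.
  change (p.[x^-1] * (expR (- x^-1) * x^-1 ^+ 2) +
          expR (- x^-1) * (p^`().[x^-1] * - x^-1 ^+ 2) =
          x^-1 ^+ 2 * (p.[x^-1] - p^`().[x^-1]) * expR (- x^-1)).
  ring.
- rewrite {2}/flat ifF; last by apply/negbTE; rewrite -leNgt ltW.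
  apply: (@near_eq_is_derive _ _ _ (cst 0)).
    near=> y; rewrite /flat ifF//; apply/negbTE; rewrite -leNgt ltW//.
    by near: y; exact: lt_nbhsl.
- rewrite flat0; apply/is_derive1_caratheodory; exists (flat (p * 'X)); split.
  + move=> z; rewrite flat0 !subr0 /flat; case: ifPn => z0; last by rewrite mul0r.
    rewrite hornerMX -!mulrA; congr (_ * _).
    by rewrite [expR _ * _]mulrC mulrA mulVf ?mul1r ?gt_eqF.
  + exact: continuous_flat0.
  + exact: flat0.
Unshelve. all: by end_near. Qed.

Lemma continuous_flat p : continuous (flat p).
Proof.
move=> x; apply/differentiable_continuous/derivable1_diffP.
by have [] := is_derive_flat p x.
Qed.

Lemma flat1_ge0 x : 0 <= flat 1 x.
Proof. by rewrite /flat; case: ifPn => // _; rewrite hornerC mul1r expR_ge0. Qed.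

Lemma flat1_le1 x : flat 1 x <= 1.
Proof.
rewrite /flat; case: ifPn => // x0.
by rewrite hornerC mul1r -expR0 ler_expR oppr_le0 invr_ge0 ltW.
Qed.

Lemma flat1_gt0 x : (0 < flat 1 x) = (0 < x).
Proof.
rewrite /flat; case: ifPn => x0; last by rewrite ltxx.
by rewrite hornerC mul1r expR_gt0.
Qed.

End flat.

(** * Functions of class C^k *)
Section line.
Context (R : realType) (V : normedModType R).

(** Reduces directional derivatives to derivatives of functions of one real
    variable, for which the chain rule is available. *)
Lemma is_derive_lineP (f : V -> R) (x v : V) df :
  is_derive x v f df <-> is_derive (0 : R) 1 (fun h : R => f (h *: v + x)) df.
Proof.
have E : 'D_v f x = 'D_1 (fun h : R => f (h *: v + x)) 0.
  rewrite /derive; set g1 := fun h => h^-1 *: _; set g2 := fun h => h^-1 *: _.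
  suff -> : g1 = g2 by [].
  by rewrite /g1 /g2; apply/funext => h /=; rewrite addr0 scale0r add0r [_%:A]mulr1.
split=> -[dv <-]; apply: DeriveDef => //.
  exact/(@derivable1P _ _ _ f x v).
exact/(@derivable1P _ _ _ f x v).
Qed.

End line.

Section Ck_closure.
Context (R : realType) (n : nat).
Implicit Types (f g : 'rV[R]_n -> R).
Local Notation S k := (Ck k setT).

Lemma Ck_continuous k f : S k f -> continuous f.
Proof. by case: k => [|k] [cf _] x; exact: cf. Qed.

Lemma Ck_pred k f : S k.+1 f -> S k f.
Proof.
elim: k f => [|k IH] f [cf df]; split => // i.
by have [dfi Dfi] := df i; split => //; exact: IH.
Qed.

Lemma CkD k f g : S k f -> S k g -> S k (fun x => f x + g x).
Proof.
elim: k f g => [|k IH] f g [cf df] [cg dg].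
  by split => // x _; apply: continuousD; [exact: cf|exact: cg].
split=> [x _|i]; first by apply: continuousD; [exact: cf|exact: cg].
have [dfi Dfi] := df i; have [dgi Dgi] := dg i; split.
  by move=> x _; apply: derivableD; [exact: dfi|exact: dgi].
rewrite (_ : 'D_'e_i _ = fun x => 'D_'e_i f x + 'D_'e_i g x); first exact: IH.
by apply/funext => x; apply: deriveD; [exact: dfi|exact: dgi].
Qed.

Lemma CkM k f g : S k f -> S k g -> S k (fun x => f x * g x).
Proof.
elim: k f g => [|k IH] f g Cf Cg.
  by split => // x _; apply: continuousM; [exact: (Ck_continuous Cf)|exact: (Ck_continuous Cg)].
split=> [x _|i].
  by apply: continuousM; [exact: (Ck_continuous Cf)|exact: (Ck_continuous Cg)].
have [_ /(_ i)[dfi Dfi]] := Cf; have [_ /(_ i) [dgi Dgi]] := Cg; split.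
  by move=> x _; apply: derivableM; [exact: dfi|exact: dgi].
rewrite (_ : 'D_'e_i _ = fun x => f x * 'D_'e_i g x + g x * 'D_'e_i f x).
  by apply: CkD; apply: IH => //; exact: Ck_pred.
by apply/funext => x; apply: deriveM; [exact: dfi|exact: dgi].
Qed.

Lemma Ck_cst k (c : R) : S k (fun _ : 'rV[R]_n => c).
Proof.
elim: k c => [|k IH] c; (split; first by move=> x _; exact: cst_continuous) => // i.
split; first by move=> x _; exact: derivable_cst.
rewrite (_ : 'D_'e_i _ = fun=> 0) ?IH//.
by apply/funext => x; exact: derive_cst.
Qed.

Lemma Ck_flat k p (c s : R) (j : 'I_n) :
  S k (fun x => flat p (c + s * x 0 j)).
Proof.
have cts q : continuous (fun x : 'rV[R]_n => flat q (c + s * x 0 j)).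
  move=> x; apply: (@continuous_comp _ _ _ (fun x : 'rV[R]_n => c + s * x 0 j) (flat q)).
    apply: (@continuousD _ _ _ (cst c)); first exact: cst_continuous.
    by apply: (@continuousM _ _ (cst s)); [exact: cst_continuous|exact: coord_continuous].
  exact: continuous_flat.
elim: k p => [|k IH] p; (split; first by move=> x _; exact: cts) => // i.
have dF x : is_derive x 'e_i (fun x : 'rV[R]_n => flat p (c + s * x 0 j))
    (flat ('X^2 * (p - p^`())) (c + s * x 0 j) * (s * (i == j)%:R)).
  apply/is_derive_lineP.
  pose l (h : R) := (c + s * x 0 j) + (s * (i == j)%:R) * h.
  rewrite (_ : (fun h => _) = flat p \o l); last first.
    by apply/funext => h /=; rewrite /l !mxE eqxx /= (eq_sym j); congr flat; ring.
  have dl : is_derive (0 : R) 1 l (s * (i == j)%:R).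
    have := is_deriveD (is_derive_cst (c + s * x 0 j) (0 : R) 1)
                       (is_deriveZ (s * (i == j)%:R) (is_derive_id (0 : R) 1)).
    by rewrite add0r /GRing.scale /= mulr1.
  by apply: is_derive1_comp; rewrite /l mulr0 addr0; exact: is_derive_flat.
split; first by move=> x _; have [] := dF x.
rewrite (_ : 'D_'e_i _ = fun x => flat ('X^2 * (p - p^`())) (c + s * x 0 j) * (s * (i == j)%:R)).
  by apply: CkM; [exact: IH|exact: Ck_cst].
by apply/funext => x; have [] := dF x.
Qed.

Lemma smooth_prod (I : Type) (r : seq I) (F : I -> 'rV[R]_n -> R) :
  (forall i, smooth (F i)) -> smooth (fun x => \prod_(i <- r) F i x).
Proof.
move=> sF k; elim: r => [|i r IH].
  under eq_fun do rewrite big_nil; exact: Ck_cst.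
under eq_fun do rewrite big_cons; apply: CkM => //; exact: sF.
Qed.

End Ck_closure.

(** * Test functions *)
Section cube_bump.
Context (R : realType) (n : nat).
Implicit Types (c x : 'rV[R]_n) (r : R).

(** In each coordinate the factor is positive exactly on the interval
    [(c_j - r, c_j + r)]. *)
Definition cube_bump c r x : R :=
  \prod_(j <- enum 'I_n) (flat 1 ((r - c 0 j) + 1 * x 0 j) * flat 1 ((r + c 0 j) + (-1) * x 0 j)).

Lemma smooth_cube_bump c r : smooth (cube_bump c r).
Proof. by apply: smooth_prod => j k; apply: CkM; exact: Ck_flat. Qed.

Lemma cube_bump_ge0 c r x : 0 <= cube_bump c r x.
Proof. by apply: prodr_ge0 => j _; rewrite mulr_ge0 ?flat1_ge0. Qed.

Lemma cube_bump_le1 c r x : cube_bump c r x <= 1.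
Proof.
rewrite /cube_bump; elim: (enum _) => [|j s IH]; rewrite (big_nil, big_cons)//.
rewrite mulr_ile1 ?mulr_ge0 ?mulr_ile1 ?flat1_ge0 ?flat1_le1//.
by apply: prodr_ge0 => i _; rewrite mulr_ge0 ?flat1_ge0.
Qed.

Lemma cube_bump_gt0 c r x : (forall j, `|x 0 j - c 0 j| < r) -> 0 < cube_bump c r x.
Proof.
move=> h; apply: prodr_gt0 => j _; have := h j; rewrite ltr_distl => /andP[h1 h2].
by rewrite mulr_gt0 ?flat1_gt0//; lra.
Qed.

Lemma cube_bump_neq0 c r x j : cube_bump c r x != 0 -> `|x 0 j - c 0 j| < r.
Proof.
rewrite /cube_bump (bigD1_seq j) ?mem_enum ?enum_uniq//= mulf_eq0 negb_or => /andP[+ _].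
rewrite mulf_eq0 negb_or => /andP[h1 h2].
have := flat1_ge0 (r - c 0 j + 1 * x 0 j).
rewrite le_eqVlt eq_sym (negbTE h1)/= flat1_gt0 => {}h1.
have := flat1_ge0 (r + c 0 j + (-1) * x 0 j).
rewrite le_eqVlt eq_sym (negbTE h2)/= flat1_gt0 => {}h2.
by rewrite ltr_distl; apply/andP; split; lra.
Qed.

End cube_bump.

Section test_functions.
Context (R : realType) (n : nat).
Implicit Types (U V : set 'rV[R]_n) (f g : 'rV[R]_n -> R).

Lemma test_function_sub U V f : U `<=` V -> test_function U f -> test_function V f.
Proof. by move=> UV [sf [K [cK KU K0]]]; split=> //; exists K; split=> // x /KU/UV. Qed.

Lemma test_functionM U f g : test_function U f -> smooth g ->
  test_function U (fun x => f x * g x).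
Proof.
move=> [sf [K [cK KU K0]]] sg; split; first by move=> k; exact: CkM.
by exists K; split=> // x /K0 ->; rewrite mul0r.
Qed.

Lemma test_functionD U f g : test_function U f -> test_function U g ->
  test_function U (fun x => f x + g x).
Proof.
move=> [sf [K [cK KU K0]]] [sg [L [cL LU L0]]]; split; first by move=> k; exact: CkD.
exists (K `|` L); split=> [|x [/KU|/LU]//|x KL]; first exact: compactU.
by rewrite K0 ?L0 ?addr0// => h; apply: KL; [right|left].
Qed.

Lemma test_function0 U : test_function U (fun=> 0).
Proof. by split; [move=> k; exact: Ck_cst|exists set0; split=> //; exact: compact0]. Qed.

Lemma test_functionZ U (c : R) f : test_function U f -> test_function U (fun x => c * f x).
Proof.
move=> tf; under eq_fun do rewrite mulrC.
by apply: test_functionM => // k; exact: Ck_cst.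
Qed.

(** For functions with values in [[0, 1]] this is a smooth union: it is positive
    exactly where one of the [F i] is, and keeps values in [[0, 1]]. *)
Lemma test_function_compl_prod (I : Type) (r : seq I) U (F : I -> 'rV[R]_n -> R) :
  (forall i, test_function U (F i)) ->
  test_function U (fun x => 1 - \prod_(i <- r) (1 - F i x)).
Proof.
move=> tF; elim: r => [|i r IH].
  by under eq_fun do rewrite big_nil subrr; exact: test_function0.
set P := fun x => 1 - \prod_(i <- r) (1 - F i x) in IH.
rewrite (_ : (fun x => _) = fun x => (F i x + P x) + (F i x * (-1 * P x))).
  apply: test_functionD; first exact: test_functionD.
  by apply: test_functionM => //; have [] := test_functionZ (-1) IH.
by apply/funext => x; rewrite big_cons /P; ring.
Qed.

Lemma test_function_out U f x : test_function U f -> ~ U x -> f x = 0.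
Proof. by move=> [_ [K [_ KU K0]]] Ux; apply: K0 => /KU. Qed.

Lemma test_function_bump U (c : 'rV[R]_n) (r : R) :
  (forall x : 'rV[R]_n, (forall j, `|x 0 j - c 0 j| <= r) -> U x) ->
  test_function U (cube_bump c r).
Proof.
move=> cU; split; first exact: smooth_cube_bump.
exists [set x : 'rV[R]_n | forall j, `[c 0 j - r, c 0 j + r]%classic (x 0 j)]; split.
- apply: (@rV_compact R n (fun j => `[c 0 j - r, c 0 j + r]%classic)) => j.
  exact: segment_compact.
- move=> x /= h; apply: cU => j; have := h j; rewrite /= in_itv/= => /andP[h1 h2].
  by rewrite ler_distl h1 h2.
- move=> x /= h; apply: contra_notP h => /eqP h j.
  have := cube_bump_neq0 j h; rewrite ltr_distl => /andP[h1 h2].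
  by rewrite /= in_itv/= !ltW.
Qed.

(** The family is indexed by the closed cubes of rational centre and radius
    contained in [U]. *)
Lemma open_bump_family U : open U -> exists psi : nat -> 'rV[R]_n -> R,
  [/\ forall k, test_function U (psi k), forall k x, 0 <= psi k x <= 1 &
      forall x, U x -> exists k, 0 < psi k x].
Proof.
move=> oU.
pose inside (qs : 'rV[rat]_n * rat) := forall x : 'rV[R]_n,
  (forall j, `|x 0 j - (map_mx ratr qs.1 : 'rV[R]_n) 0 j| <= ratr qs.2) -> U x.
pose B (qs : 'rV[rat]_n * rat) : 'rV[R]_n -> R :=
  if pselect (inside qs) then cube_bump (map_mx ratr qs.1) (ratr qs.2) else fun=> 0.
have tB qs : test_function U (B qs).
  by rewrite /B; case: pselect => [h|h]; [exact: test_function_bump|exact: test_function0].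
have B01 qs x : 0 <= B qs x <= 1.
  rewrite /B; case: pselect => [h|h]; first by rewrite cube_bump_ge0 cube_bump_le1.
  by rewrite lexx ler01.
(* Codes of cubes not inside U, and integers that code nothing, give 0. *)
exists (fun k => if unpickle k is Some qs then B qs else fun=> 0); split.
- by move=> k; case: unpickle => [qs|]; [exact: tB|exact: test_function0].
- by move=> k x; case: unpickle => [qs|]; [exact: B01|rewrite lexx ler01].
move=> x Ux.
have [e /= e0 eU] : nbhs_ball x U by apply/nbhs_ballP/open_nbhs_nbhs.
have [s] : exists s : rat, ratr s \in `](0 : R), (e / 2)[.
  by apply: rat_in_itvoo; rewrite divr_gt0.
rewrite in_itv/= => /andP[s0 se].
have /choice[q qP] (i : 'I_n) : exists q : rat, `|x 0 i - ratr q| < ratr s.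
  have [q qi] : exists q : rat, ratr q \in `](x 0 i - ratr s), (x 0 i + ratr s)[.
    by apply: rat_in_itvoo; rewrite ltrBlDr -addrA ltrDl addr_gt0.
  exists q; move: qi; rewrite in_itv/= => /andP[q1 q2].
  by rewrite distrC ltr_distl q1 q2.
exists (pickle (\row_i q i, s)); rewrite pickleK /B; case: pselect => [h|[]].
  by apply: cube_bump_gt0 => j; rewrite !mxE; exact: qP.
move=> y /= hy; apply: eU; split=> // i j; rewrite ord1 /ball /=.
have := hy j; have := qP j; rewrite !mxE => h1 h2.
apply: le_lt_trans (ler_distD (ratr (q j)) _ _) _.
rewrite [ltRHS]splitr distrC ler_ltD//.
  by rewrite distrC ltW// (lt_trans h1).
by rewrite distrC (le_lt_trans h2).
Qed.

(** With [psi] a family as above, [1 - (\prod_(j < N) (1 - psi j))^N] works: at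
    a point where some [psi k] is positive, the power is eventually at most
    [(1 - psi k)^N], which tends to 0. *)
Lemma open_indic_approx U : open U -> exists chi : nat -> 'rV[R]_n -> R,
  [/\ forall k, test_function U (chi k), forall k x, 0 <= chi k x <= 1 &
      forall x, chi ^~ x @ \oo --> (\1_U x : R)].
Proof.
move=> /open_bump_family[psi [tp p01 pU]].
pose P N x := \prod_(j <- iota 0 N) (1 - psi j x).
have P01 N x : 0 <= P N x <= 1.
  rewrite /P; elim: (iota 0 N) => [|j s /andP[IH1 IH2]]; rewrite (big_nil, big_cons) ?lexx ?ler01//.
  have /andP[h1 h2] := p01 j x.
  by rewrite mulr_ge0 ?subr_ge0//= mulr_ile1// ?subr_ge0// gerBl.
exists (fun N x => 1 - \prod_(i <- iota 0 N) (1 - (1 - P N x))); split.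
- move=> N; apply: (@test_function_compl_prod _ _ _ (fun i x => 1 - P N x)) => _.
  exact: test_function_compl_prod.
- move=> N x; under eq_bigr do rewrite subKr.
  rewrite big_const_seq count_predT iter_mulr mulr1 subr_ge0 gerBl.
  by have /andP[h1 h2] := P01 N x; rewrite exprn_ge0// exprn_ile1.
move=> x.
under eq_fun do under eq_bigr do rewrite subKr.
under eq_fun do rewrite big_const_seq count_predT iter_mulr mulr1 size_iota.
rewrite indicE; have [/set_mem Ux|/negP xU] := boolP (x \in U); last first.
  have P1 N : P N x = 1.
    rewrite /P big1// => j _; rewrite (test_function_out (tp j)) ?subr0//.
    by move=> /mem_set.
  under eq_fun do rewrite P1 expr1n subrr; exact: cvg_cst.
have [k k0] := pU _ Ux.
have /andP[_ k1] := p01 k x.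
have -> : true%:R = 1 - 0 :> R by rewrite subr0.
apply: cvgB; first exact: cvg_cst.
apply: (@squeeze_cvgr _ _ _ _ (cst 0) (fun N => (1 - psi k x) ^+ N)).
- near=> N; have /andP[h1 h2] := P01 N x.
  rewrite exprn_ge0//= lerXn2r ?nnegrE ?subr_ge0//.
  have kN : (k < N)%N by near: N; exact: nbhs_infty_gt.
  rewrite /P (bigD1_seq k) ?mem_iota ?iota_uniq//= ler_piMr ?subr_ge0//.
  apply: prodr_ile1 => j _; have /andP[h3 h4] := p01 j x.
  by rewrite subr_ge0 h4 gerBl.
- exact: cvg_cst.
- apply: cvg_expr; rewrite ger0_norm ?subr_ge0//; lra.
Unshelve. all: by end_near. Qed.

End test_functions.

(** * Square integrals *)
Lemma EFin_splitr4 (R : realType) (e : R) :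
  e%:E = (2%:E * (e / 4)%:E + 2%:E * (e / 4)%:E)%E.
Proof. by rewrite -!EFinM -EFinD; congr EFin; field. Qed.

Section sqnorm.
Context d (T : measurableType d) (R : realType).
Variables (m : {measure set T -> \bar R}) (D : set T).
Hypothesis mD : measurable D.
Implicit Types f g h : T -> R.

Definition sqnorm f : \bar R := (\int[m]_(x in D) (f x ^+ 2)%:E)%E.

Lemma measurable_sqr f : measurable_fun D f -> measurable_fun D (fun x => (f x ^+ 2)%:E).
Proof. by move=> mf; apply/measurable_EFinP; exact: measurable_funX. Qed.

Lemma sqnorm_ge0 f : (0 <= sqnorm f)%E.
Proof. by apply: integral_ge0 => x _; rewrite lee_fin sqr_ge0. Qed.

Lemma le_sqnorm f g : measurable_fun D f -> measurable_fun D g ->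
  (forall x, D x -> `|f x| <= `|g x|) -> (sqnorm f <= sqnorm g)%E.
Proof.
move=> mf mg fg; apply: ge0_le_integral => //.
- by move=> x _; rewrite lee_fin sqr_ge0.
- exact: measurable_sqr.
- exact: measurable_sqr.
- move=> x /fg h; rewrite lee_fin -(real_normK (num_real (f x))).
  by rewrite -(real_normK (num_real (g x))) lerXn2r.
Qed.

Lemma eq_sqnorm f g : (forall x, D x -> f x = g x) -> sqnorm f = sqnorm g.
Proof. by move=> fg; apply: eq_integral => x /set_mem /fg ->. Qed.

Lemma sqnormZ c f : measurable_fun D f ->
  sqnorm (fun x => c * f x) = ((c ^+ 2)%:E * sqnorm f)%E.
Proof.
move=> mf; rewrite /sqnorm; under eq_integral do rewrite exprMn EFinM.
apply: ge0_integralZl_EFin => //; rewrite ?sqr_ge0//; last exact: measurable_sqr.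
by move=> x _; rewrite lee_fin sqr_ge0.
Qed.

Lemma sqnormD f g : measurable_fun D f -> measurable_fun D g ->
  (sqnorm (fun x => (f x + g x)%R) <= 2%:E * sqnorm f + 2%:E * sqnorm g)%E.
Proof.
move=> mf mg.
have s0 (u : T -> R) x : D x -> (0 <= 2%:E * (u x ^+ 2)%:E)%E.
  by move=> _; rewrite mule_ge0// lee_fin sqr_ge0.
have ms (u : T -> R) : measurable_fun D u -> measurable_fun D (fun x => 2%:E * (u x ^+ 2)%:E)%E.
  by move=> mu; apply: measurable_funeM; exact: measurable_sqr.
rewrite /sqnorm -!ge0_integralZl//; try exact: measurable_sqr;
  try by move=> x _; rewrite lee_fin sqr_ge0.
rewrite -ge0_integralD//; try exact: ms; try exact: s0.
apply: ge0_le_integral => //.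
- by move=> x _; rewrite lee_fin sqr_ge0.
- by apply: measurable_sqr; exact: measurable_funD.
- by apply: emeasurable_funD; exact: ms.
move=> x _; rewrite -!EFinM -EFinD lee_fin.
have := sqr_ge0 (f x - g x); lra.
Qed.

Lemma integrable_sqr f : measurable_fun D f -> (sqnorm f < +oo)%E ->
  m.-integrable D (fun x => (f x ^+ 2)%:E).
Proof.
move=> mf f2; apply/integrableP; split; first exact: measurable_sqr.
by under eq_integral do rewrite abse_EFin ger0_norm ?sqr_ge0//.
Qed.

(** The dominated convergence theorem in L^2. *)
Lemma sqnorm_dominated (f_ : nat -> T -> R) f h :
  (forall k, measurable_fun D (f_ k)) -> measurable_fun D f ->
  measurable_fun D h -> (sqnorm h < +oo)%E ->
  (forall x, D x -> f_ ^~ x @ \oo --> f x) ->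
  (forall k x, D x -> `|f x - f_ k x| <= `|h x|) ->
  sqnorm (fun x => f x - f_ k x) @[k --> \oo] --> 0%E.
Proof.
move=> mf_ mf mh h2 ff fh.
have -> : (0 = \int[m]_(x in D) (cst 0 x))%E by rewrite integral0.
have [] := @dominated_convergence _ _ _ m D mD (fun k x => ((f x - f_ k x) ^+ 2)%:E)
  (cst 0%E) (fun x => (h x ^+ 2)%:E).
- by move=> k; apply: measurable_sqr; exact: measurable_funB.
- by [].
- apply: aeW => x Dx; apply: cvg_EFin; first by near=> k.
  have -> : (0 = (f x - f x) * (f x - f x) :> R) by rewrite subrr mul0r.
  by apply: cvgM; apply: cvgB; (exact: cvg_cst || exact: ff).
- exact: integrable_sqr.
- apply: aeW => x k Dx; rewrite abse_EFin lee_fin ger0_norm ?sqr_ge0//.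
  rewrite -(real_normK (num_real (h x))) -[X in X <= _](real_normK (num_real _)).
  by rewrite lerXn2r ?nnegrE// fh.
- by [].
Unshelve. all: by end_near. Qed.

End sqnorm.

Section rV_measurable.
Context (R : realType) (n : nat).

Lemma measurable_open (U : set 'rV[R]_n) : open U -> measurable U.
Proof. by move=> oU; exact: sub_sigma_algebra. Qed.

Lemma continuous_measurable_rV (f : 'rV[R]_n -> R) (D : set 'rV[R]_n) :
  continuous f -> measurable_fun D f.
Proof.
move=> cf; apply: (measurable_funS measurableT) => //.
apply: (measurability _ (RGenOpens.measurableE R)) => _ [_ [a [b ->]] <-].
rewrite setTI; apply: measurable_open.
apply: open_comp; last exact: interval_open.
by move=> v _; exact: cf.
Qed.

End rV_measurable.

(** * Density of test functions in L^2 of a finite measure *)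
Section density.
Context (R : realType) (n : nat) (U : set 'rV[R]_n).
Variable m : {measure set 'rV[R]_n -> \bar R}.
Hypotheses (oU : open U) (mUoo : (m U < +oo)%E).

Let mU : measurable U. Proof. exact: measurable_open. Qed.

Definition test_approx (f : 'rV[R]_n -> R) := forall e : R, 0 < e ->
  exists2 phi, test_function U phi & (sqnorm m U (fun x => (f x - phi x)%R) < e%:E)%E.

Lemma test_function_measurable V phi (D : set 'rV[R]_n) :
  test_function V phi -> measurable_fun D phi.
Proof.
move=> [sp _]; apply: continuous_measurable_rV.
exact: (Ck_continuous (sp 0%N)).
Qed.

Lemma test_approxD (f g : 'rV[R]_n -> R) : measurable_fun U f -> measurable_fun U g ->
  test_approx f -> test_approx g -> test_approx (fun x => f x + g x).
Proof.
move=> mf mg af ag e e0.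
have e4 : 0 < e / 4 by rewrite divr_gt0.
have [phi tp fp] := af _ e4; have [psi ts gs] := ag _ e4.
exists (fun x => phi x + psi x); first exact: test_functionD.
have mp := test_function_measurable (D := U) tp.
have ms := test_function_measurable (D := U) ts.
under [X in sqnorm _ _ X]eq_fun do rewrite opprD addrACA.
apply: le_lt_trans (sqnormD _ _ _ _) _ => //; try exact: measurable_funB.
by rewrite [ltRHS]EFin_splitr4 lteD// lte_pmul2l.
Qed.

Lemma test_approxZ (c : R) (f : 'rV[R]_n -> R) : measurable_fun U f ->
  test_approx f -> test_approx (fun x => c * f x).
Proof.
move=> mf af e e0.
have c0 : 0 < c ^+ 2 + 1 by rewrite ltr_wpDl ?sqr_ge0.
have [phi tp fp] := af (e / (c ^+ 2 + 1)) (divr_gt0 e0 c0).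
exists (fun x => c * phi x); first exact: test_functionZ.
have mp := test_function_measurable (D := U) tp.
under [X in sqnorm _ _ X]eq_fun do rewrite -mulrBr.
rewrite sqnormZ//; last exact: measurable_funB.
apply: (@le_lt_trans _ _ ((c ^+ 2 + 1)%:E * sqnorm m U (fun x => (f x - phi x)%R))%E).
  by apply: lee_wpmul2r; rewrite ?sqnorm_ge0// lee_fin lerDl.
rewrite [X in (_ < X%:E)%E](_ : e = (c ^+ 2 + 1) * (e / (c ^+ 2 + 1))); last first.
  by field; rewrite gt_eqF.
by rewrite EFinM lte_pmul2l.
Qed.

Lemma test_approx_lim (f_ : nat -> 'rV[R]_n -> R) (f h : 'rV[R]_n -> R) :
  (forall k, measurable_fun U (f_ k)) -> measurable_fun U f ->
  measurable_fun U h -> (sqnorm m U h < +oo)%E ->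
  (forall x, U x -> f_ ^~ x @ \oo --> f x) ->
  (forall k x, U x -> `|f x - f_ k x| <= `|h x|) ->
  (forall k, test_approx (f_ k)) -> test_approx f.
Proof.
move=> mf_ mf mh h2 ff fh af e e0.
have e4 : 0 < e / 4 by rewrite divr_gt0.
have /fine_cvgP := sqnorm_dominated mU mf_ mf mh h2 ff fh.
move=> [[N1 _ fin]] /cvgrPdist_lt /(_ _ e4) [N2 _ dist].
pose k := maxn N1 N2.
have := fin k (leq_maxl _ _); have := dist k (leq_maxr _ _) => /=.
rewrite sub0r normrN => hk fk.
have {}hk : (sqnorm m U (fun x => (f x - f_ k x)%R) < (e / 4)%:E)%E.
  by rewrite -(fineK fk) lte_fin (le_lt_trans (ler_norm _)).
have [phi tp fp] := af k _ e4.
exists phi => //.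
have mp := test_function_measurable (D := U) tp.
rewrite (@eq_sqnorm _ _ _ m U _ (fun x => (f x - f_ k x) + (f_ k x - phi x))); last first.
  by move=> x _; rewrite addrA subrK.
apply: le_lt_trans (sqnormD _ _ _ _) _ => //; try exact: measurable_funB.
by rewrite [ltRHS]EFin_splitr4 lteD// lte_pmul2l.
Qed.

Lemma test_approx_test phi : test_function U phi -> test_approx phi.
Proof.
move=> tp e e0; exists phi => //.
rewrite (@eq_sqnorm _ _ _ m U _ (cst 0)); last by move=> x _; rewrite subrr.
by rewrite /sqnorm; under eq_integral do rewrite expr0n/=; rewrite integral0 lte_fin.
Qed.

Lemma sqnorm_cst (c : R) : (sqnorm m U (cst c) < +oo)%E.
Proof. by rewrite /sqnorm (integral_cst _ mU (c ^+ 2)%:E)// lte_mul_pinfty// lee_fin sqr_ge0. Qed.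

Lemma test_approx_indic_lim (A_ : nat -> set 'rV[R]_n) A :
  (forall k, measurable (A_ k)) -> measurable A ->
  (forall x, (\1_(A_ k) x : R) @[k --> \oo] --> (\1_A x : R)) ->
  (forall k, test_approx \1_(A_ k)) -> test_approx \1_A.
Proof.
move=> mA_ mA AA aA; apply: (@test_approx_lim (fun k => \1_(A_ k)) _ (cst 1)) => //.
- exact: sqnorm_cst.
- move=> k x _; rewrite /cst normr1 !indicE.
  by do 2 case: (_ \in _); rewrite ?subrr ?subr0 ?sub0r ?normrN ?normr1 ?normr0.
Qed.

Lemma test_approx_open V : open V -> test_approx \1_V.
Proof.
move=> oV.
have [chi [tc c01 cV]] := open_indic_approx (openI oU oV).
have cUV k : test_function U (chi k) by apply: test_function_sub (tc k); exact: subIsetl.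
apply: (@test_approx_lim chi _ (cst 1)) => //.
- by move=> k; exact: test_function_measurable (tc k).
- by apply: measurable_indic; exact: measurable_open.
- exact: sqnorm_cst.
- move=> x Ux; rewrite (_ : \1_V x = \1_(U `&` V) x) ?cV//.
  by rewrite !indicE in_setI (mem_set Ux).
- move=> k x _; rewrite /cst normr1 indicE; have /andP[h1 h2] := c01 k x.
  by case: (_ \in _); rewrite ?mulr1n ?mulr0n ler_norml; apply/andP; split; lra.
- by move=> k; exact: test_approx_test.
Qed.

(** The sets whose indicator can be approximated form a lambda-system, which
    contains the open sets, a pi-system generating the Borel sets. *)
Lemma test_approx_indic A : measurable A -> test_approx \1_A.
Proof.
suff : (@measurable _ 'rV[R]_n) `<=` [set A | measurable A /\ test_approx \1_A].
  by move=> h /h[].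
clear A.
apply: (@lambda_system_subset _ (open : set (set 'rV[R]_n))) => //.
- by move=> V W; exact: openI.
- split => //.
  + by split=> //; apply: test_approx_open; exact: openT.
  + move=> A B BA [mA aA] [mB aB]; split; first exact: measurableD.
    rewrite (_ : \1_(A `\` B) = fun x => \1_A x + (-1) * \1_B x); last first.
      apply/funext => x; rewrite !indicE in_setD.
      have [xB|xB] := boolP (x \in B).
        by rewrite (mem_set (BA _ (set_mem xB))) /= mulr1 subrr.
      by rewrite andbT mulr0 addr0.
    apply: test_approxD => //; try exact: measurable_indic.
      by apply: measurable_funM => //; exact: measurable_indic.
    by apply: test_approxZ => //; exact: measurable_indic.
  + move=> F ndF aF; have mF k : measurable (F k) by have [] := aF k.
    split; first exact: bigcupT_measurable.
    apply: (@test_approx_indic_lim F) => //.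
    * exact: bigcupT_measurable.
    * move=> x; rewrite indicE; have [/set_mem[k _ Fk]|xF] := boolP (x \in _).
        apply: cvg_near_cst; near=> j; rewrite indicE mem_set//.
        have kj : (k <= j)%N by near: j; exact: nbhs_infty_ge.
        by move: Fk; exact/subsetPset/ndF.
      apply: cvg_near_cst; near=> j; rewrite indicE memNset// => Fj.
      by move/negP: xF; apply; apply/mem_set; exists j.
    * by move=> k; have [] := aF k.
- move=> V oV; split; [exact: measurable_open|exact: test_approx_open].
Unshelve. all: by end_near. Qed.

Import HBNNSimple.

Lemma test_approx_sfun (g : {nnsfun 'rV[R]_n >-> R}) : test_approx g.
Proof.
rewrite (_ : (g : _ -> R) = fun x => \sum_(y <- finmap.enum_fset (fset_set (range g)))
    (y * \1_(g @^-1` [set y]) x)); last first.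
  by apply/funext => x; rewrite (fimfunE g x) fsbig_finite.
elim: (finmap.enum_fset _) => [|y s IH].
  under eq_fun do rewrite big_nil; apply: test_approx_test; exact: test_function0.
under eq_fun do rewrite big_cons.
have mi z : measurable_fun U (fun x => z * \1_(g @^-1` [set z]) x).
  by apply: measurable_funM => //; exact: measurable_indic.
apply: test_approxD => //; first by apply: measurable_sum.
by apply: test_approxZ; [exact: measurable_indic|exact: test_approx_indic].
Qed.

Lemma test_approx_nonneg (f : 'rV[R]_n -> R) : measurable_fun U f -> (forall x, 0 <= f x) ->
  (sqnorm m U f < +oo)%E -> test_approx f.
Proof.
move=> mf f0 f2.
have mEf : measurable_fun U (EFin \o f) by exact/measurable_EFinP.
pose g := nnsfun_approx mU mEf.
have gf x : U x -> (fun k => g k x) @ \oo --> f x.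
  move=> Ux.
  have : (EFin \o (fun k => g k x)) @ \oo --> (f x)%:E.
    by apply: (cvg_nnsfun_approx mU mEf) => // y _; rewrite /= lee_fin.
  by move/fine_cvg.
have gle k x : U x -> g k x <= f x.
  move=> Ux.
  have nd : nondecreasing_seq (fun k => g k x).
    by move=> i j ij; have /lefP := nd_nnsfun_approx mU mEf ij; exact.
  have := nondecreasing_cvgn_le nd (cvgP _ (gf x Ux)) k.
  by rewrite (cvg_lim _ (gf x Ux)).
apply: (@test_approx_lim (fun k => g k : _ -> R) f f) => //.
- by move=> k; exact: measurable_funS (measurable_funPT (g k)).
- move=> k x Ux; rewrite !ger0_norm ?subr_ge0 ?gle//.
  by rewrite gerBl; exact: fun_ge0.
- by move=> k; exact: test_approx_sfun.
Qed.

Lemma test_dense (f : 'rV[R]_n -> R) :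
  measurable_fun U f -> (sqnorm m U f < +oo)%E -> test_approx f.
Proof.
move=> mf f2.
have sg (g : 'rV[R]_n -> R) : measurable_fun U g -> (sqnorm m U g <= sqnorm m U f)%E ->
    (forall x, 0 <= g x) -> test_approx g.
  by move=> mg gf g0; apply: test_approx_nonneg => //; exact: le_lt_trans gf _.
rewrite (_ : f = fun x => Num.max (f x) 0 + (-1) * Num.max (- f x) 0); last first.
  apply/funext => x; rewrite mulN1r; case: (lerP 0 (f x)) => h.
    by rewrite max_r ?oppr_le0 ?subr0.
  by rewrite max_l ?oppr_ge0 ?ltW// opprK add0r.
have m1 : measurable_fun U (fun x => Num.max (f x) 0) by exact: measurable_maxr.
have m2 : measurable_fun U (fun x => Num.max (- f x) 0).
  by apply: measurable_maxr => //; exact: measurableT_comp.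
apply: test_approxD => //; first exact: measurable_funM.
  apply: sg => // [|x]; last by rewrite le_max lexx orbT.
  apply: le_sqnorm => // x _; case: (lerP 0 (f x)) => h; rewrite ?normr0//.
apply: test_approxZ => //.
apply: sg => // [|x]; last by rewrite le_max lexx orbT.
apply: le_sqnorm => // x _; case: (lerP 0 (- f x)) => h; rewrite ?normr0 ?normrN//.
Qed.

End density.

(** * Integrals of derivatives of compactly supported functions *)
Lemma continuous_rV (R : realType) n (T : topologicalType) (f : T -> 'rV[R]_n) :
  (forall i, continuous (fun t => f t 0 i)) -> continuous f.
Proof.
move=> cf t; apply/cvg_ballP => e e0.
have H : \forall s \near t, forall i, ball (f t 0 i) e (f s 0 i).
  by apply: filter_forall => i; have /cvg_ballP := cf i t; exact.
by apply: filterS H => s h; split=> // i j; rewrite ord1.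
Qed.

Section cons_rV.
Context (R : realType) (n : nat).

Lemma continuous_cons_rVl (y : 'rV[R]_n) : continuous (fun t : R => cons_rV (t, y)).
Proof.
apply: continuous_rV => k; case: (unliftP ord0 k) => [j|] -> t.
  by under eq_fun do rewrite cons_rVS; exact: cst_continuous.
by under eq_fun do rewrite cons_rV0; exact: cvg_id.
Qed.

Lemma continuous_cons_rVr (t : R) : continuous (fun y : 'rV[R]_n => cons_rV (t, y)).
Proof.
apply: continuous_rV => k; case: (unliftP ord0 k) => [j|] -> y.
  by under eq_fun do rewrite cons_rVS; exact: coord_continuous.
by under eq_fun do rewrite cons_rV0; exact: cst_continuous.
Qed.

Lemma cons_rV_shift0 (h t : R) (y : 'rV[R]_n) :
  h *: 'e_ord0 + cons_rV (t, y) = cons_rV (h * 1 + t, y).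
Proof.
apply/rowP => k; rewrite mxE; case: (unliftP ord0 k) => [j|] ->.
  by rewrite !cons_rVS !mxE /= mulr0 add0r.
by rewrite !cons_rV0 !mxE /=.
Qed.

Lemma cons_rV_shiftS (h t : R) (y : 'rV[R]_n) (j : 'I_n) :
  h *: 'e_(lift ord0 j) + cons_rV (t, y) = cons_rV (t, h *: 'e_j + y).
Proof.
apply/rowP => k; rewrite mxE; case: (unliftP ord0 k) => [l|] ->.
  by rewrite !cons_rVS !mxE /= (inj_eq lift_inj).
by rewrite !cons_rV0 !mxE /= mulr0 add0r.
Qed.

End cons_rV.

Section lebesgue_cube.
Context (R : realType).

Definition cube n (M : R) : set 'rV[R]_n := [set x | forall i, `|x 0 i| <= M].

Lemma cubeE n (M : R) : @cube n M = [set x | forall i, `[- M, M]%classic (x 0 i)].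
Proof. by apply/seteqP; split=> x /= h i; have := h i; rewrite /= in_itv/= ler_norml. Qed.

Lemma compact_cube n (M : R) : compact (@cube n M).
Proof.
by rewrite cubeE; apply: (@rV_compact R n (fun=> `[- M, M]%classic)) => i; exact: segment_compact.
Qed.

Lemma continuous_bounded_cube n (f : 'rV[R]_n -> R) (M : R) : continuous f ->
  bounded_set (f @` cube M).
Proof.
move=> cf; apply: compact_bounded; apply: continuous_compact; last exact: compact_cube.
exact: continuous_subspaceT.
Qed.

Lemma measurable_cube n (M : R) : measurable (@cube n M).
Proof.
rewrite (_ : cube _ = \bigcap_(i in [set: 'I_n]) ((fun x : 'rV[R]_n => x 0 i) @^-1` `[- M, M])).
  apply: fin_bigcap_measurable => [|i _]; first exact: finite_finset.
  by rewrite -[X in measurable X]setTI; apply: measurable_coord.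
by rewrite cubeE; apply/seteqP; split=> x /= h i; [move=> _|]; exact: h.
Qed.

Lemma cons_rV_cube n (M : R) : @cons_rV R n @^-1` cube M = `[- M, M]%classic `*` cube M.
Proof.
apply/seteqP; split=> [[t y] h|[t y] [/= ht hy]].
  split=> /= [|i]; first by have := h ord0; rewrite cons_rV0 /= in_itv/= ler_norml.
  by have := h (lift ord0 i); rewrite cons_rVS.
move=> k; case: (unliftP ord0 k) => [j|] ->; rewrite ?cons_rVS ?cons_rV0 //=.
by move: ht; rewrite in_itv/= ler_norml.
Qed.

Lemma lebesgue_cube_lty n (M : R) : (lebesgue_rV R n (@cube n M) < +oo)%E.
Proof.
elim: n => [|n IH]; first by rewrite /= diracE ltry.
rewrite /= /lebesgue_rV_step /pushforward cons_rV_cube.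
rewrite product_measure1E//; last exact: measurable_cube.
have h : (@lebesgue_measure R [set` `[(- M)%R, M%R]] < +oo)%E.
  by rewrite lebesgue_measure_itv/=; case: ifP => _; rewrite -?EFinB ltry.
by rewrite lte_mul_pinfty// ge0_fin_numE.
Qed.

Lemma bounded_sub_cube n (A : set 'rV[R]_n) : bounded_set A ->
  exists2 M, 0 < M & A `<=` cube M.
Proof.
move=> [M [_ /(_ (`|M| + 1))]]; rewrite ltr_pwDr ?ler_norm// => /(_ isT) h.
exists (`|M| + 1); first by rewrite ltr_wpDl.
move=> x /h /= hx i; apply: le_trans hx.
by rewrite [leRHS]/Num.norm /= mx_normrE; apply/bigmax_geP; right => /=; exists (0, i).
Qed.

Lemma lebesgue_bounded_lty n (A : set 'rV[R]_n) : bounded_set A -> measurable A ->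
  (lebesgue_rV R n A < +oo)%E.
Proof.
move=> /bounded_sub_cube[M _ AM] mA.
apply: le_lt_trans (lebesgue_cube_lty n M).
by apply: le_measure; rewrite ?inE//; exact: measurable_cube.
Qed.

End lebesgue_cube.

Section integral_derivative.
Context (R : realType).

(** The fundamental theorem of calculus on an interval whose endpoints lie
    outside the support. *)
Lemma integral1_derivative (u g : R -> R) (M : R) : 0 < M ->
  (forall t : R, is_derive t 1 u (g t)) -> continuous g ->
  (forall t : R, M < `|t| -> u t = 0) -> (forall t : R, M < `|t| -> g t = 0) ->
  (\int[@lebesgue_measure R]_t (g t)%:E = 0)%E.
Proof.
move=> M0 du cg u0 g0.
pose N := M + 1.
have NM : - N < N by rewrite /N; lra.
have cu t : {for t, continuous u}.
  by apply/differentiable_continuous/derivable1_diffP; have [] := du t.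
transitivity (\int[@lebesgue_measure R]_(t in `[(- N)%R, N]) (g t)%:E)%E.
  rewrite [RHS]integral_mkcond; apply: eq_integral => t _; rewrite patchE.
  case: ifPn => // /negP; rewrite inE /= in_itv/= => /negP tN; rewrite g0//.
  by rewrite -ler_norml -ltNge in tN; apply: lt_trans tN; rewrite /N ltrDl.
rewrite (@continuous_FTC2 _ g u)//.
- by rewrite !u0 ?subee// ?normrN gtr0_norm /N; lra.
- exact: continuous_subspaceT.
- split; first by move=> x _; have [] := du x.
    exact/cvg_at_right_filter/cu.
  exact/cvg_at_left_filter/cu.
- by move=> x _; rewrite derive1E; have [] := du x.
Qed.

(** Stated along a map [p] because it is needed on the product space where the
    measure of ['rV_n.+1] is pulled back, and not on ['rV_n.+1] itself. *)
Lemma integrable_cube d (T : measurableType d) (m : {measure set T -> \bar R}) n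
    (p : T -> 'rV[R]_n) (g : 'rV[R]_n -> R) M :
  measurable_fun setT p -> (m (p @^-1` cube M) < +oo)%E -> continuous g ->
  (forall x, ~ cube M x -> g x = 0) -> m.-integrable setT (EFin \o (g \o p)).
Proof.
move=> mp mM cg g0.
have mC : measurable (p @^-1` cube M).
  by rewrite -[X in measurable X]setTI; apply: mp => //; exact: measurable_cube.
have -> : EFin \o (g \o p) = (EFin \o (g \o p)) \_ (p @^-1` cube M).
  apply/funext => x; rewrite patchE; case: ifPn => // /negP; rewrite inE /= => /g0 h.
  by rewrite h.
apply/(integrable_mkcond (D := p @^-1` cube M)) => //; apply: measurable_bounded_integrable => //.
  apply: measurable_funTS; apply: measurableT_comp => //.
  exact: continuous_measurable_rV.
have [B [Br hB]] := continuous_bounded_cube M cg; exists B; split=> // C /hB h x Cx; apply: h => /=; exists (p x) => //.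
Qed.

(** Fubini's theorem reduces the first coordinate to the one-dimensional case,
    and any other coordinate to a smaller dimension. The derivative [g] is
    asked to vanish outside the cube as well, which is automatic for a test
    function and spares an argument about its support at each step. *)
Lemma integral_derivative n (w g : 'rV[R]_n -> R) (i : 'I_n) M : 0 < M ->
  (forall x, is_derive x 'e_i w (g x)) -> continuous g ->
  (forall x, ~ cube M x -> w x = 0) -> (forall x, ~ cube M x -> g x = 0) ->
  (\int[lebesgue_rV R n]_x (g x)%:E = 0)%E.
Proof.
move=> M0; elim: n w g i => [|n IH] w g i dw cg w0 g0; first by case: i dw.
have int : (@lebesgue_measure R \x lebesgue_rV R n)%E.-integrable setT
    (EFin \o (g \o @cons_rV R n)).
  apply: (integrable_cube (M := M)) => //.
  exact: (lebesgue_cube_lty n.+1 M).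
have mg : measurable_fun setT (EFin \o g).
  by apply/measurable_EFinP; exact: continuous_measurable_rV.
transitivity (\int[@lebesgue_measure R \x lebesgue_rV R n]_p (g (cons_rV p))%:E)%E.
  by have := @integral_pushforward _ _ _ _ _ (@cons_rV R n) (@measurable_cons_rV R n) _ setT
    (EFin \o g) mg int measurableT.
have outl t y : M < `|t| -> ~ cube M (@cons_rV R n (t, y)).
  by move=> Mt /(_ ord0); rewrite cons_rV0 leNgt Mt.
have outr t y : ~ cube M y -> ~ cube M (@cons_rV R n (t, y)).
  by move=> My h; apply: My => j; have := h (lift ord0 j); rewrite cons_rVS.
move: dw; case: (unliftP ord0 i) => [j|] -> dw.
- rewrite -(integral12_prod_meas1 int); apply: integral0_eq => t _.
  apply: (IH (fun y => w (cons_rV (t, y))) (fun y => g (cons_rV (t, y))) j).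
  + move=> y; apply/is_derive_lineP.
    have /is_derive_lineP := dw (cons_rV (t, y)).
    by under eq_fun do rewrite cons_rV_shiftS.
  + move=> y; apply: continuous_comp; [exact: continuous_cons_rVr|exact: cg].
  + by move=> y /outr h; apply: w0.
  + by move=> y /outr h; apply: g0.
- rewrite -(integral21_prod_meas1 int); apply: integral0_eq => y _.
  apply: (@integral1_derivative (fun t => w (cons_rV (t, y)))
    (fun t => g (cons_rV (t, y))) M) => //.
  + move=> t; apply/is_derive_lineP.
    have /is_derive_lineP := dw (cons_rV (t, y)).
    by under eq_fun do rewrite cons_rV_shift0.
  + move=> t; apply: continuous_comp; [exact: continuous_cons_rVl|exact: cg].
  + by move=> t /outl h; apply: w0.
  + by move=> t /outl h; apply: g0.
Qed.

End integral_derivative.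

(** * Integration by parts and the fundamental lemma *)
Lemma continuous_mul (R : realType) (T : topologicalType) (f g : T -> R) :
  continuous f -> continuous g -> continuous (fun x => f x * g x).
Proof. by move=> cf cg x; apply: (@continuousM _ _ f g); [exact: cf|exact: cg]. Qed.

Lemma continuous_add (R : realType) (T : topologicalType) (f g : T -> R) :
  continuous f -> continuous g -> continuous (fun x => f x + g x).
Proof. by move=> cf cg x; apply: (@continuousD _ _ _ f g); [exact: cf|exact: cg]. Qed.

Section real_part.
Context (R : realType) (n : nat) (U : set 'rV[R]_n).
Hypotheses (oU : open U) (bU : bounded_set U).
Implicit Types (f g phi : 'rV[R]_n -> R).

Let mU : measurable U. Proof. exact: measurable_open. Qed.

Lemma continuous_bounded_on f : continuous f -> [bounded f x | x in U].
Proof.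
move=> cf; have [M _ UM] := bounded_sub_cube bU.
have [B [Br hB]] := continuous_bounded_cube M cf.
by exists B; split=> // C /hB h x Ux; apply: h => /=; exists x => //; exact: UM.
Qed.

Lemma continuous_integrable (m : {measure set 'rV[R]_n -> \bar R}) f :
  (m U < +oo)%E -> continuous f -> m.-integrable U (EFin \o f).
Proof.
move=> mUoo cf; apply: measurable_bounded_integrable => //.
  exact: continuous_measurable_rV.
exact: continuous_bounded_on.
Qed.

Lemma lebesgue_lty : (lebesgue_rV R n U < +oo)%E.
Proof. exact: lebesgue_bounded_lty. Qed.

Lemma continuous_sqnorm_lty f : continuous f -> (sqnorm (lebesgue_rV R n) U f < +oo)%E.
Proof.
move=> cf; apply: integrable_lty => //.
apply: (@continuous_integrable _ (fun x => f x ^+ 2) lebesgue_lty).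
by move=> x; apply: (@continuousM _ _ f f); exact: cf.
Qed.

Lemma test_functionP phi : test_function U phi ->
  exists M, [/\ 0 < M, forall x, ~ cube M x -> phi x = 0 &
    forall i x, ~ cube M x \/ ~ U x -> 'D_'e_i phi x = 0].
Proof.
move=> [sp [K [cK KU K0]]].
have [M M0 KM] := bounded_sub_cube (compact_bounded cK).
exists M; split=> // [x Mx|i x MUx]; first by apply: K0 => /KM.
have Kx : ~ K x by move=> Kx; case: MUx => h; apply: h; [exact: KM|exact: KU].
rewrite (@near_eq_derive _ _ _ _ (cst 0)) ?derive_cst//.
have oK : open (~` K) by apply: closed_openC; apply: compact_closed.
by have := open_nbhs_nbhs (conj oK Kx); apply: filterS => y; exact: K0.
Qed.

Lemma smooth_derivable f i x : smooth f -> derivable f x 'e_i.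
Proof. by move=> /(_ 1%N) [_ /(_ i)[df _]]; exact: df. Qed.

Lemma smooth_derive f i : smooth f -> smooth ('D_'e_i f).
Proof. by move=> sf k; have [_ /(_ i)[]] := sf k.+1. Qed.

Lemma smooth_continuous f : smooth f -> continuous f.
Proof. by move=> sf; exact: Ck_continuous (sf 0%N). Qed.

Lemma Rintegral_by_parts f phi i : smooth f -> test_function U phi ->
  \int[lebesgue_rV R n]_(x in U) (f x * 'D_'e_i phi x) =
  - \int[lebesgue_rV R n]_(x in U) ('D_'e_i f x * phi x).
Proof.
move=> sf tp; have [sp _] := tp.
have [M [M0 p0 dp0]] := test_functionP tp.
have cf := smooth_continuous sf; have cp := smooth_continuous sp.
have cdf := smooth_continuous (smooth_derive i sf).
have cdp := smooth_continuous (smooth_derive i sp).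
pose g x := f x * 'D_'e_i phi x + phi x * 'D_'e_i f x.
have c1 : continuous (fun x => f x * 'D_'e_i phi x).
  exact: continuous_mul.
have c2 : continuous (fun x => 'D_'e_i f x * phi x).
  exact: continuous_mul.
have c3 : continuous g.
  by apply: continuous_add; exact: continuous_mul.
apply/eqP; rewrite -addr_eq0 -RintegralD//;
  try by apply: continuous_integrable; first exact: lebesgue_lty.
have gE x : f x * 'D_'e_i phi x + 'D_'e_i f x * phi x = g x by rewrite [_ * phi x]mulrC.
under eq_Rintegral do rewrite gE.
have dw x : is_derive x 'e_i (fun x => f x * phi x) (g x).
  apply: DeriveDef; first by apply: derivableM; exact: smooth_derivable.
  by apply: (@deriveM _ _ f phi); exact: smooth_derivable.
have := integral_derivative M0 dw c3.
rewrite /Rintegral integral_mkcond => H; rewrite (_ : _ \_ U = EFin \o g); last first.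
  apply/funext => x; rewrite patchE; case: ifPn => // /negP; rewrite inE => Ux.
  by rewrite /= /g dp0 ?(test_function_out tp)//; [rewrite mulr0 mul0r addr0|right].
by rewrite [X in fine X]H//= => x Mx; rewrite /g p0 ?dp0 ?mulr0 ?mul0r ?addr0//; left.
Qed.

Lemma integrableM_sq (m : {measure set 'rV[R]_n -> \bar R}) f g :
  measurable_fun U f -> measurable_fun U g ->
  (sqnorm m U f < +oo)%E -> (sqnorm m U g < +oo)%E ->
  m.-integrable U (EFin \o (fun x => f x * g x)).
Proof.
move=> mf mg f2 g2.
apply: (@le_integrable _ _ _ m U mU _ (fun x => (f x ^+ 2)%:E + (g x ^+ 2)%:E)%E).
- by apply/measurable_EFinP; exact: measurable_funM.
- move=> x _; rewrite -EFinD !abse_EFin lee_fin normrM [leRHS]ger0_norm ?addr_ge0 ?sqr_ge0//.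
  rewrite -(real_normK (num_real (f x))) -(real_normK (num_real (g x))).
  have := sqr_ge0 (`|f x| - `|g x|); have := normr_ge0 (f x); have := normr_ge0 (g x); nra.
- by apply: integrableD => //; exact: integrable_sqr.
Qed.

(** The fundamental lemma of the calculus of variations in L^2, by density: if
    [phi] is a test function close to [f], then [f^2 <= (f - phi)^2 + 2 f phi],
    and the integral of the last term is zero. *)
Lemma sqnorm_eq0 f : measurable_fun U f -> (sqnorm (lebesgue_rV R n) U f < +oo)%E ->
  (forall phi, test_function U phi -> \int[lebesgue_rV R n]_(x in U) (f x * phi x) = 0) ->
  sqnorm (lebesgue_rV R n) U f = 0%E.
Proof.
move=> mf f2 f0; apply/eqP; rewrite eq_le sqnorm_ge0 andbT.
apply/lee_addgt0Pr => e e0; rewrite add0e.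
have [phi tp fp] := test_dense oU lebesgue_lty mf f2 e0.
have mp := test_function_measurable (D := U) tp.
have cp : continuous phi by have [sp _] := tp; exact: smooth_continuous.
have p2 := continuous_sqnorm_lty cp.
have ifp := integrableM_sq mf mp f2 p2.
have fp0 : (\int[lebesgue_rV R n]_(x in U) (f x * phi x)%:E = 0)%E.
  rewrite -(fineK (integrable_fin_num mU ifp)).
  by have := f0 _ tp; rewrite /Rintegral => ->.
have id : (lebesgue_rV R n).-integrable U (fun x => ((f x - phi x) ^+ 2)%:E).
  apply: (@integrable_sqr _ _ _ (lebesgue_rV R n) U (fun x => f x - phi x)).
    exact: measurable_funB.
  by apply: lt_trans fp _; rewrite ltry.
have i2 : (lebesgue_rV R n).-integrable U (fun x => 2%:E * (f x * phi x)%:E)%E.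
  exact: integrableZl.
apply: (@le_trans _ _ (\int[lebesgue_rV R n]_(x in U)
   (((f x - phi x) ^+ 2)%:E + 2%:E * (f x * phi x)%:E))%E).
  apply: le_integral => //; first exact: integrable_sqr.
    exact: integrableD.
  move=> x _; rewrite -EFinM -EFinD lee_fin.
  have := sqr_ge0 (phi x); lra.
rewrite integralD// integralZl// fp0 mule0 adde0; exact: ltW.
Qed.

Lemma sqnorm0_Rintegral f phi : measurable_fun U f -> continuous phi ->
  sqnorm (lebesgue_rV R n) U f = 0%E ->
  \int[lebesgue_rV R n]_(x in U) (f x * phi x) = 0.
Proof.
move=> mf cp f0.
have aef : ae_eq (lebesgue_rV R n) U (fun x => (f x ^+ 2)%:E) (cst 0%E).
  apply/ae_eq_integral_abs => //; first exact: measurable_sqr.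
  by rewrite -[RHS]f0; apply: eq_integral => x _; rewrite abse_EFin ger0_norm ?sqr_ge0.
rewrite /Rintegral (@ae_eq_integral _ _ _ _ _ (cst 0%E)) ?integral0//.
- apply/measurable_EFinP; apply: measurable_funM => //; exact: continuous_measurable_rV.
- apply: filterS aef => x /= h Ux; have [/eqP] := h Ux.
  by rewrite sqrf_eq0 => /eqP ->; rewrite mul0r.
Qed.

End real_part.

(** * Sobolev norms of smooth functions *)
Section normc.
Context (R : realType).
Local Notation normc := ComplexField.Normc.normc.
Implicit Types z w : R[i].

Lemma normc_sqr z : normc z ^+ 2 = complex.Re z ^+ 2 + complex.Im z ^+ 2.
Proof. by case: z => a b /=; rewrite sqr_sqrtr// addr_ge0 ?sqr_ge0. Qed.

Lemma Re_mulC z (c : R) : complex.Re (z * c%:C%C) = complex.Re z * c.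
Proof. by case: z => a b /=; rewrite mulr0 subr0. Qed.

Lemma Im_mulC z (c : R) : complex.Im (z * c%:C%C) = complex.Im z * c.
Proof. by case: z => a b /=; rewrite mulr0 add0r. Qed.

Lemma Re_sub z w : complex.Re (z - w) = complex.Re z - complex.Re w.
Proof. by case: z; case: w. Qed.

Lemma Im_sub z w : complex.Im (z - w) = complex.Im z - complex.Im w.
Proof. by case: z; case: w. Qed.

Lemma normc_nneg z : 0 <= normc z.
Proof. by case: z => a b /=; rewrite sqrtr_ge0. Qed.

End normc.

Lemma smoothB (R : realType) n (f g : 'rV[R]_n -> R) :
  smooth f -> smooth g -> smooth (fun x => f x - g x).
Proof.
move=> sf sg k; rewrite (_ : (fun x => _) = fun x => f x + (-1) * g x); last first.
  by apply/funext => x; rewrite mulN1r.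
by apply: CkD => //; apply: CkM => //; exact: Ck_cst.
Qed.

Section sobolev_part.
Context (R : realType) (n : nat) (U : set 'rV[R]_n).
Hypotheses (oU : open U) (bU : bounded_set U).
Local Notation lambda := (lebesgue_rV R n).
Local Notation fct := ('rV[R]_n -> R[i]).
Implicit Types u v g : fct.

Let mU : measurable U. Proof. exact: measurable_open. Qed.

Lemma L2norm2E u :
  measurable_fun U (fun x => complex.Re (u x)) -> measurable_fun U (fun x => complex.Im (u x)) ->
  L2norm2 lambda U u = (sqnorm lambda U (fun x => complex.Re (u x)) +
                        sqnorm lambda U (fun x => complex.Im (u x)))%E.
Proof.
move=> mr mi; rewrite /L2norm2; under eq_integral do rewrite normc_sqr EFinD.
by rewrite ge0_integralD//; try (by move=> x _; rewrite lee_fin sqr_ge0); exact: measurable_sqr.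
Qed.

Lemma L2E u : L2 U u <->
  [/\ measurable_fun U (fun x => complex.Re (u x)),
      measurable_fun U (fun x => complex.Im (u x)),
      (sqnorm lambda U (fun x => complex.Re (u x)) < +oo)%E &
      (sqnorm lambda U (fun x => complex.Im (u x)) < +oo)%E].
Proof.
split=> [[mr mi h]|[mr mi hr hi]].
  rewrite L2norm2E// in h; split=> //; apply: le_lt_trans h.
    by rewrite leeDl// sqnorm_ge0.
  by rewrite leeDr// sqnorm_ge0.
by split=> //; rewrite L2norm2E// lte_add_pinfty.
Qed.

Lemma weak_derivativeE i u g : weak_derivative U i u g <->
  forall phi, test_function U phi ->
    \int[lambda]_(x in U) (complex.Re (u x) * 'D_'e_i phi x) =
    - (\int[lambda]_(x in U) (complex.Re (g x) * phi x)) /\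
    \int[lambda]_(x in U) (complex.Im (u x) * 'D_'e_i phi x) =
    - \int[lambda]_(x in U) (complex.Im (g x) * phi x).
Proof.
have E v psi : Cintegral lambda U (fun x => v x * (psi x)%:C%C) =
   ((\int[lambda]_(x in U) (complex.Re (v x) * psi x)) +i*
    (\int[lambda]_(x in U) (complex.Im (v x) * psi x)))%C.
  rewrite /Cintegral; congr Complex; apply: eq_Rintegral => x _; [exact: Re_mulC|exact: Im_mulC].
split=> h phi /h; rewrite !E; first by case.
by case=> -> ->.
Qed.

Lemma Csmooth_L2 u : Csmooth u -> L2 U u.
Proof.
move=> [/smooth_continuous cr /smooth_continuous ci]; apply/L2E; split.
- exact: continuous_measurable_rV.
- exact: continuous_measurable_rV.
- exact: continuous_sqnorm_lty.
- exact: continuous_sqnorm_lty.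
Qed.

Lemma Csmooth_weak_derivative i u : Csmooth u ->
  exists2 g, weak_derivative U i u g & Csmooth g.
Proof.
move=> [sr si].
exists (fun x => ('D_'e_i (fun x => complex.Re (u x)) x +i*
                  'D_'e_i (fun x => complex.Im (u x)) x)%C).
  by apply/weak_derivativeE => phi tp; split=> /=; exact: Rintegral_by_parts.
by split=> /=; exact: smooth_derive.
Qed.

Lemma Csmooth_sobolev k u : Csmooth u -> sobolev U k u.
Proof.
elim: k u => [|k IH] u su; split => //; try exact: Csmooth_L2.
move=> i; have [g ug sg] := Csmooth_weak_derivative i su.
by exists g; split=> //; exact: IH.
Qed.

Definition null u := L2 U u /\ L2norm2 lambda U u = 0%E.

Lemma nullE u : null u <->
  [/\ measurable_fun U (fun x => complex.Re (u x)),
      measurable_fun U (fun x => complex.Im (u x)),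
      sqnorm lambda U (fun x => complex.Re (u x)) = 0%E &
      sqnorm lambda U (fun x => complex.Im (u x)) = 0%E].
Proof.
split=> [[/L2E[mr mi hr hi]]|[mr mi hr hi]].
  rewrite L2norm2E// => /eqP; rewrite padde_eq0 ?sqnorm_ge0// => /andP[/eqP h1 /eqP h2].
  by split.
split; last by rewrite L2norm2E// hr hi adde0.
by apply/L2E; split=> //; rewrite ?hr ?hi ltry.
Qed.

Lemma null0 : null (fun=> 0).
Proof.
apply/nullE; split=> //=; try exact: measurable_cst.
  by rewrite /sqnorm; apply: integral0_eq => x _; rewrite expr0n.
by rewrite /sqnorm; apply: integral0_eq => x _; rewrite expr0n.
Qed.

Lemma weak_derivative_null i u g : null u -> L2 U g -> weak_derivative U i u g -> null g.
Proof.
move=> /nullE[mr mi ur ui] /L2E[gmr gmi gr gi] /weak_derivativeE h.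
apply/nullE; split=> //; apply: sqnorm_eq0 => // phi tp.
  have [/eqP + _] := h _ tp; have [/(@smooth_derive _ _ _ i)/smooth_continuous cd _] := tp.
  by rewrite (sqnorm0_Rintegral oU mr cd ur) eq_sym oppr_eq0 => /eqP.
have [_ /eqP +] := h _ tp; have [/(@smooth_derive _ _ _ i)/smooth_continuous cd _] := tp.
by rewrite (sqnorm0_Rintegral oU mi cd ui) eq_sym oppr_eq0 => /eqP.
Qed.

(** The choice made by [wD] is determined only up to null sets, so [wD] need not
    map [0] to [0]; it does preserve [null]. *)
Lemma null_wD i u : null u -> null (wD U i u).
Proof.
move=> nu; rewrite /wD; case: xgetP => [g _ [gL2 ug]|_]; last exact: null0.
exact: weak_derivative_null ug.
Qed.

Lemma null_sobolev_norm2 k u : null u -> sobolev_norm2 U k u = 0%E.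
Proof.
elim: k u => [|k IH] u nu /=; have [_ ->] := nu; first by rewrite adde0.
by rewrite add0e big1// => i _; apply: IH; exact: null_wD.
Qed.

Lemma sobolev_cvg_cst k u : sobolev_cvg U k (fun=> u) u.
Proof.
rewrite /sobolev_cvg; have -> : (fun x => u x - u x) = (fun=> 0).
  by apply/funext => x; rewrite subrr.
by rewrite (null_sobolev_norm2 k null0); exact: cvg_cst.
Qed.

(** * The mean of a smooth function *)
Section mean.
Variable mu : probability 'rV[R]_n R.
Local Notation normc := ComplexField.Normc.normc.

Lemma Csmooth_integrable u : Csmooth u ->
  mu.-integrable U (EFin \o (fun x => complex.Re (u x))) /\
  mu.-integrable U (EFin \o (fun x => complex.Im (u x))).
Proof.
move=> [/smooth_continuous cr /smooth_continuous ci].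
have muU : (mu U < +oo)%E by rewrite (le_lt_trans (probability_le1 mu mU))// ltry.
by split; exact: continuous_integrable.
Qed.

Lemma CintegralB u v : Csmooth u -> Csmooth v ->
  Cintegral mu U (fun x => u x - v x) = Cintegral mu U u - Cintegral mu U v.
Proof.
move=> /Csmooth_integrable[ru iu] /Csmooth_integrable[rv iv].
rewrite /Cintegral /=; congr Complex.
  under eq_Rintegral do rewrite Re_sub; exact: RintegralB.
under eq_Rintegral do rewrite Im_sub; exact: RintegralB.
Qed.

Lemma CsmoothB u v : Csmooth u -> Csmooth v -> Csmooth (fun x => u x - v x).
Proof.
move=> [ru iu] [rv iv]; split.
  under eq_fun do rewrite Re_sub; exact: smoothB.
under eq_fun do rewrite Im_sub; exact: smoothB.
Qed.

(** The constant sequence [u] witnesses the value; any other approximating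
    sequence has the same limit since the mean is bounded by the H^2 norm. *)
Lemma mean_Csmooth u : mean_continuous U mu -> Csmooth u -> mean U mu u = Cintegral mu U u.
Proof.
move=> [c hc] su; apply: xget_unique.
  exists (fun=> u); split=> //; first exact: sobolev_cvg_cst.
  rewrite subrr ComplexField.Normc.normc0; exact: cvg_cst.
move=> z [v [sv vu vz]].
apply/eqP; rewrite -subr_eq0; apply/eqP; apply: ComplexField.Normc.eq0_normc.
apply/eqP; rewrite eq_le normc_nneg andbT; apply/ler_addgt0Pr => e e0; rewrite add0r.
have e2 : 0 < e / 2 by rewrite divr_gt0.
have : (c%:E * sobolev_norm2 U 2 (fun x => (v n x - u x)%R))%E @[n --> \oo] --> 0%E.
  by rewrite -(mule0 c%:E); apply: cvgeZl.
move=> /fine_cvgP[[N1 _ fin]] /cvgrPdist_lt /(_ _ (exprn_gt0 2 e2)) [N2 _ dist].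
move: vz => /cvgrPdist_lt /(_ _ e2) [N3 _ vz].
pose k := maxn N1 (maxn N2 N3).
have {}fin := fin k (leq_maxl _ _).
have {}dist : `|0 - fine (c%:E * sobolev_norm2 U 2 (fun x => (v k x - u x)%R))%E| < (e / 2) ^+ 2.
  by apply: dist => /=; rewrite /k !leq_max leqnn orbT.
have {}vz : `|0 - normc (Cintegral mu U (v k) - z)| < e / 2.
  by apply: vz => /=; rewrite /k !leq_max leqnn !orbT.
have := hc _ (CsmoothB (sv k) su).
rewrite CintegralB// -(fineK fin) lee_fin => hk.
have {}hk : normc (Cintegral mu U (v k) - Cintegral mu U u) < e / 2.
  rewrite -(@ltr_pXn2r _ 2) ?nnegrE ?normc_nneg ?ltW//.
  by apply: le_lt_trans hk _; move: dist; rewrite sub0r normrN; apply: le_lt_trans; exact: ler_norm.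
move: vz; rewrite sub0r normrN ger0_norm ?normc_nneg// => vz.
rewrite -(subrK (Cintegral mu U (v k)) z) -addrA.
apply: le_trans (le_normcD _ _) _.
rewrite [leRHS]splitr lerD// ltW//.
by rewrite -opprB normcN.
Qed.

End mean.

End sobolev_part.

(** * Smooth functions equal to their mean outside the domain *)
Section dense.
Context (R : realType) (n : nat) (U : set 'rV[R]_n) (mu : probability 'rV[R]_n R).
Hypotheses (oU : open U) (bU : bounded_set U) (mu1 : mu U = 1%E).
Local Notation lambda := (lebesgue_rV R n).
Local Notation avg f := (\int[mu]_(x in U) (f x)).

Let mU : measurable U. Proof. exact: measurable_open. Qed.

Let muU : (mu U < +oo)%E. Proof. by rewrite mu1 ltry. Qed.

Lemma avg_cst (c : R) : avg (fun=> c) = c.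
Proof. by rewrite Rintegral_cst// -[RHS]mulr1; congr (_ * _); exact: (congr1 fine mu1). Qed.

(** Approximating 1 with respect to the sum of both measures makes [chi] close
    to 1 for each. *)
Lemma test_cutoff (d : R) : 0 < d -> exists2 chi, test_function U chi &
  (sqnorm lambda U (fun x => (1 - chi x)%R) < d%:E)%E /\ 1 / 2 <= avg chi.
Proof.
move=> d0.
pose e := Num.min d (1 / 4).
have e0 : 0 < e by rewrite lt_min d0 divr_gt0.
pose m : {measure set 'rV[R]_n -> \bar R} := measure_add lambda mu.
have mUoo : (m U < +oo)%E.
  have -> : m U = (lambda U + mu U)%E by exact: measure_addE.
  by rewrite lte_add_pinfty// lebesgue_lty.
have [||chi tc] := @test_dense R n U m oU mUoo (cst 1) _ _ e e0; first exact: measurable_cst.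
  exact: sqnorm_cst.
have cc : continuous chi by case: tc => sc _; exact: smooth_continuous.
have mc : measurable_fun U (fun x => ((1 - chi x) ^+ 2)%:E).
  by apply: measurable_sqr; apply: measurable_funB => //; exact: continuous_measurable_rV.
rewrite /sqnorm ge0_integral_measure_add// => [|x _]; last by rewrite lee_fin sqr_ge0.
rewrite -/(sqnorm lambda U (fun x => 1 - chi x)) -/(sqnorm mu U (fun x => 1 - chi x)) => hc.
have hl : (sqnorm lambda U (fun x => (1 - chi x)%R) < e%:E)%E.
  by apply: le_lt_trans hc; rewrite leeDl// sqnorm_ge0.
have hm : (sqnorm mu U (fun x => (1 - chi x)%R) < e%:E)%E.
  by apply: le_lt_trans hc; rewrite leeDr// sqnorm_ge0.
exists chi => //; split.
  by apply: lt_le_trans hl _; rewrite lee_fin ge_min lexx.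
have c1 : continuous (fun x => 1 - chi x).
  by apply: smooth_continuous; apply: smoothB; [move=> k; exact: Ck_cst|case: tc].
have i2 : mu.-integrable U (EFin \o (fun x => (1 - chi x) ^+ 2)).
  by apply: continuous_integrable => //; exact: continuous_mul.
have ic : mu.-integrable U (EFin \o chi) by exact: continuous_integrable.
have icst (c : R) : mu.-integrable U (EFin \o (fun=> c)).
  by apply: continuous_integrable => //; exact: cst_continuous.
(* As t <= 1/4 + t^2 for t = 1 - chi, the average of chi is at least
   3/4 - 1/4. *)
have : avg (fun x => 3 / 4 - (1 - chi x) ^+ 2) <= avg chi.
  apply: le_Rintegral => //; first exact: (integrableB mU (icst (3 / 4)) i2).
  by move=> x _; have := sqr_ge0 (chi x - 1 / 2); lra.
apply: le_trans.
rewrite RintegralB// avg_cst.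
have : avg (fun x => (1 - chi x) ^+ 2) <= 1 / 4.
  rewrite -lee_fin /Rintegral fineK; last exact: integrable_fin_num.
  by apply: le_trans (ltW hm) _; rewrite lee_fin ge_min lexx orbT.
lra.
Qed.

(** The function [u = phi + a (1 - chi)] described at the beginning. The
    constant [c] bounds [a^2] in terms of [phi] alone, as [\int chi dmu >= 1/2],
    so that [chi] may be chosen after it. *)
Lemma dense_constant_outside (f : 'rV[R]_n -> R) (e : R) :
  measurable_fun U f -> (sqnorm lambda U f < +oo)%E -> 0 < e ->
  exists u : 'rV[R]_n -> R, [/\ smooth u, forall x, ~ U x -> u x = avg u &
    (sqnorm lambda U (fun x => (f x - u x)%R) < e%:E)%E].
Proof.
move=> mf f2 e0.
have e4 : 0 < e / 4 by rewrite divr_gt0.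
have [phi tp fp] := test_dense oU (lebesgue_lty oU bU) mf f2 e4.
pose c := 4 * avg phi ^+ 2 + 1.
have c0 : 0 < c by rewrite ltr_wpDl// mulr_ge0// sqr_ge0.
have [chi tc [chi2 chi1]] := test_cutoff (divr_gt0 e4 c0).
pose a := avg phi / avg chi.
have achi0 : 0 < avg chi by apply: lt_le_trans chi1; rewrite divr_gt0.
have a2 : a ^+ 2 <= c.
  rewrite /a expr_div_n ler_pdivrMr ?exprn_gt0//.
  have q2 : 1 / 4 <= avg chi ^+ 2 by move: chi1; set q := avg chi => chi1; nra.
  have := sqr_ge0 (avg phi); rewrite /c; move: q2; move: (avg phi ^+ 2) (avg chi ^+ 2) => p q.
  nra.
have [sp _] := tp; have [sc _] := tc.
have cp := smooth_continuous sp; have cc := smooth_continuous sc.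
have ip : mu.-integrable U (EFin \o phi) by exact: continuous_integrable.
have s1 : smooth (fun x => 1 - chi x).
  by apply: smoothB => // k; exact: Ck_cst.
have c1 := smooth_continuous s1.
have i1 : mu.-integrable U (EFin \o (fun x => 1 - chi x)) by exact: continuous_integrable.
have sa : smooth (fun x => a * (1 - chi x)).
  by move=> k; apply: CkM => //; exact: Ck_cst.
have ia : mu.-integrable U (EFin \o (fun x => a * (1 - chi x))).
  by apply: continuous_integrable => //; exact: smooth_continuous.
exists (fun x => phi x + a * (1 - chi x)); split.
- by move=> k; exact: CkD.
- move=> x Ux; rewrite (test_function_out tp)// (test_function_out tc)// add0r subr0 mulr1.
  rewrite RintegralD// RintegralZl// RintegralB//; last 2 first.
  + by apply: continuous_integrable => //; exact: cst_continuous.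
  + exact: continuous_integrable.
  rewrite avg_cst mulrBr mulr1 /a divfK ?gt_eqF//.
  by rewrite addrC subrK.
have -> : (fun x => f x - (phi x + a * (1 - chi x))) =
          (fun x => (f x - phi x) + (- a) * (1 - chi x)).
  by apply/funext => x; rewrite opprD addrA mulNr.
have m1 : measurable_fun U (fun x => 1 - chi x) by exact: continuous_measurable_rV.
have mfp : measurable_fun U (fun x => f x - phi x).
  by apply: measurable_funB => //; exact: continuous_measurable_rV.
apply: le_lt_trans (sqnormD _ _ _ _) _ => //; first exact: measurable_funM.
rewrite [ltRHS]EFin_splitr4 lteD// lte_pmul2l// sqnormZ// sqrrN.
apply: (@le_lt_trans _ _ (c%:E * sqnorm lambda U (fun x => (1 - chi x)%R))%E).
  by apply: lee_wpmul2r; rewrite ?sqnorm_ge0// lee_fin.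
rewrite [X in (_ < X%:E)%E](_ : e / 4 = c * (e / 4 / c)); last first.
  by rewrite [RHS]mulrC divfK// gt_eqF.
by rewrite EFinM lte_pmul2l.
Qed.

End dense.

Unset Implicit Arguments.

Theorem proposition2p4 (R : realType) (d : nat) (Omega : set 'rV[R]_d)
  (a : 'rV[R]_d -> 'M[R]_d) (mu : probability 'rV[R]_d R)
  (d_ge2 : (2 <= d)%N)
  (Omega_open : open Omega)
  (Omega_bounded : bounded_set Omega)
  (Omega_connected : connected Omega)
  (Omega_C2 : C2_boundary Omega)
  (a_C1 : forall i j, C1_closure Omega (fun x => a x i j))
  (a_sym : forall x, Omega x -> (a x)^T = a x)
  (a_elliptic : exists2 c : R, 0 < c &
     forall (xi : 'rV[R]_d) x, Omega x ->
       c * enorm xi ^+ 2 <= (xi *m a x *m xi^T) 0 0)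
  (mu_radon : radon_probability Omega mu)
  (mu_continuous : mean_continuous Omega mu) :
  densely_defined Omega (Hmu Omega a mu).
Proof.
split=> [u [[uL2 _] _]//|f /(L2E Omega_open)[mr mi fr fi] e e0].
have [mu1 _] := mu_radon.
have e2 : 0 < e ^+ 2 / 2 by rewrite divr_gt0// exprn_gt0.
have [ur [sr our hr]] := dense_constant_outside Omega_open Omega_bounded mu1 mr fr e2.
have [ui [si oui hi]] := dense_constant_outside Omega_open Omega_bounded mu1 mi fi e2.
pose u x := (ur x +i* ui x)%C.
have su : Csmooth u by split.
exists u.
  split; first exact: Csmooth_sobolev.
  exists (fun=> u); split=> //; first exact: sobolev_cvg_cst.
  rewrite (_ : (fun _ : nat => _) = fun=> 0%E); first exact: cvg_cst.
  apply/funext => _; apply: integral0_eq => x [_].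
  move/interior_id: (Omega_open) => -> Ux.
  rewrite mean_Csmooth// /Cintegral /u /= (our _ Ux) (oui _ Ux) !subrr.
  by rewrite !expr0n addr0 sqrtr0 expr0n.
have mur := continuous_measurable_rV (D := Omega) (smooth_continuous sr).
have mui := continuous_measurable_rV (D := Omega) (smooth_continuous si).
rewrite L2norm2E//.
- rewrite (splitr (e ^+ 2)) EFinD lteD//.
    by under [X in sqnorm _ _ X]eq_fun do rewrite Re_sub.
  by under [X in sqnorm _ _ X]eq_fun do rewrite Im_sub.
- by under eq_fun do rewrite Re_sub; exact: measurable_funB.
- by under eq_fun do rewrite Im_sub; exact: measurable_funB.
Qed.
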